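(* Let $H$ be a computable infinite-dimensional Hilbert space over $\mathbb{R}$. Then $\mathrm{FRR}_H \equiv_{\mathrm W} \mathrm{MCT}$, where $\mathrm{MCT}:\subseteq \mathbb{R}^{\mathbb{N}}\to\mathbb{R}$, $(x_n)_n\mapsto \sup_{n\in\mathbb{N}} x_n$, is defined on the monotone increasing bounded sequences of reals, and $\mathrm{FRR}_H:\subseteq \mathcal{C}(H)\to H$, $f_y\mapsto y$, is defined on the linear bounded functionals $f:H\to\mathbb{R}$ and maps each such $f$ to the unique $y\in H$ with $f=f_y$, where $f_y(x)=\langle x,y\rangle$ (this $y$ also satisfies $\|y\|=\|f\|$).
   Context: A computable metric space is a metric space with a dense sequence $(a_n)_n$ such that the distances $d(a_i,a_j)$ form a computable double sequence of reals; points are represented by fast converging Cauchy sequences from $(a_n)_n$. A computable Hilbert space is such a space whose metric comes from a norm induced by an inner product $\langle\cdot,\cdot\rangle$, which is complete, and for which the vector space operations and inner product are computable in the standard sense. $\mathcal{C}(H)$ is the space of continuous functions $H\to\mathbb{R}$ with its standard representation; $\mathbb{R}^{\mathbb N}$ carries the product of the Cauchy representation. $\|f\|=\sup_{\|x\|\le 1}|f(x)|$. For partial (multi-valued) functions $f,g$ on represented spaces, $f\le_{\mathrm W} g$ (Weihrauch reducibility) means there are computable multi-valued functions $H,K$ with $\emptyset\neq H(x,gK(x))\subseteq f(x)$ for all $x\in\mathrm{dom}(f)$; $f\equiv_{\mathrm W} g$ means reducibility in both directions. *)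

(* Defs.v *)
From HB Require Import structures.
From Stdlib Require Cantor.
From mathcomp Require Import all_boot all_order all_algebra.
From mathcomp Require Import sesquilinear.
From mathcomp Require Import all_classical all_reals all_analysis.

Set Implicit Arguments.
Unset Strict Implicit.
Unset Printing Implicit Defensive.

Import Order.TTheory GRing.Theory Num.Theory.
Import numFieldNormedType.Exports.

Local Open Scope classical_set_scope.
Local Open Scope ring_scope.

Definition baire := nat -> nat.

Definition npair (m n : nat) : nat := Cantor.to_nat (m, n).
Definition nfst (n : nat) : nat := (Cantor.of_nat n).1.
Definition nsnd (n : nat) : nat := (Cantor.of_nat n).2.

Lemma npairK1 m n : nfst (npair m n) = m.
Proof. by rewrite /nfst /npair Cantor.cancel_of_to. Qed.

Lemma npairK2 m n : nsnd (npair m n) = n.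
Proof. by rewrite /nsnd /npair Cantor.cancel_of_to. Qed.

Lemma npair_fst_snd n : npair (nfst n) (nsnd n) = n.
Proof. by rewrite /npair /nfst /nsnd -surjective_pairing Cantor.cancel_to_of. Qed.

(** Unary mu-recursive functions relative to an oracle; Cantor pairing encodes
    several arguments. *)
Inductive code : Type :=
| Zero | Succ | Fst | Snd | Oracle
| Pair of code & code
| Comp of code & code
| Rec of code & code
| Mu of code.

(** [sem p c n y]: with oracle [p], the program [c] halts on [n] with output
    [y].  [Rec] recurses on the second component of its input, and [Mu c] returns
    the least [y] with [c] vanishing at [(n, y)] and defined before. *)
Fixpoint sem (p : baire) (c : code) (n y : nat) {struct c} : Prop :=
  match c with
  | Zero => y = 0%N
  | Succ => y = n.+1
  | Fst => y = nfst n
  | Snd => y = nsnd n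
  | Oracle => y = p n
  | Pair c1 c2 => exists u v, [/\ sem p c1 n u, sem p c2 n v & y = npair u v]
  | Comp c1 c2 => exists2 u, sem p c2 n u & sem p c1 u y
  | Rec c1 c2 => exists s : nat -> nat,
      [/\ sem p c1 (nfst n) (s 0%N),
          forall k, (k < nsnd n)%N ->
            sem p c2 (npair (nfst n) (npair k (s k))) (s k.+1)
        & y = s (nsnd n)]
  | Mu c1 => sem p c1 (npair n y) 0%N /\
      forall k, (k < y)%N -> exists v, sem p c1 (npair n k) v.+1
  end.

Lemma sem_fun p c n y z : sem p c n y -> sem p c n z -> y = z.
Proof.
elim: c n y z => /= [||||| c1 IH1 c2 IH2| c1 IH1 c2 IH2| c1 IH1 c2 IH2| c1 IH1]
  n y z; try by move=> -> ->.
- move=> [u [v [u1 v2 ->]]] [u' [v' [u1' v2' ->]]].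
  by rewrite (IH1 _ _ _ u1 u1') (IH2 _ _ _ v2 v2').
- by move=> [u u2 uy] [u' u2' uz]; rewrite (IH2 _ _ _ u2' u2) in uz; exact: IH1 uz.
- move=> [s [s0 sS ->]] [t [t0 tS ->]].
  suff st k : (k <= nsnd n)%N -> s k = t k by exact: st.
  elim: k => [_|k IHk kn]; first exact: IH1 s0 t0.
  by have := tS k kn; rewrite -IHk ?(ltnW kn)//; exact: IH2 (sS k kn).
- move=> [y0 yS] [z0 zS]; case: (ltngtP y z) => // [yz|zy].
  + by have [v /(IH1 _ _ _ y0)] := zS _ yz.
  + by have [v /(IH1 _ _ _ z0)] := yS _ zy.
Qed.

(** The partial functional on Baire space computed by [c] maps [p] to [q]. *)
Definition computes (c : code) (p q : baire) := forall n, sem p c n (q n).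

(** [name p x] is the graph of the representation, a partial surjection from
    Baire space onto the carrier. *)
Record represented := Represented {
  rcarrier :> Type ;
  name : baire -> rcarrier -> Prop ;
  name_fun : forall p x y, name p x -> name p y -> x = y ;
  name_surj : forall x, exists p, name p x }.

Arguments name : clear implicits.

Definition computable_point (X : represented) (x : X) :=
  exists c p, computes c (fun=> 0%N) p /\ name X p x.

(** A partial multi-valued function is a relation; its domain is the set of points
    with at least one value. *)
Definition multifun (X Y : Type) := X -> Y -> Prop.

Definition mdom X Y (f : multifun X Y) : set X := [set x | exists y, f x y].

Definition computable_multifun (X Y : represented) (f : multifun X Y) :=
  exists c, forall p x, name X p x -> mdom f x ->
    exists q y, [/\ computes c p q, name Y q y & f x y].

Definition computable_fun (X Y : represented) (f : X -> Y) :=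
  @computable_multifun X Y (fun x y => y = f x).

Definition even_part (r : baire) : baire := fun n => r n.*2.
Definition odd_part (r : baire) : baire := fun n => r n.*2.+1.

Section ProductSpace.
Variables X Y : represented.

Definition prod_name (r : baire) (z : X * Y) :=
  name X (even_part r) z.1 /\ name Y (odd_part r) z.2.

Lemma prod_name_fun r z t : prod_name r z -> prod_name r t -> z = t.
Proof.
case: z t => [x y] [x' y'] [/= rx ry] [/= rx' ry'].
by rewrite (name_fun rx rx') (name_fun ry ry').
Qed.

Lemma prod_name_surj z : exists r, prod_name r z.
Proof.
have [p px] := name_surj z.1; have [q qy] := name_surj z.2.
exists (fun n => if odd n then q n./2 else p n./2); split.
- rewrite (_ : even_part _ = p)//; apply/funext => n.
  by rewrite /even_part odd_double doubleK.
- rewrite (_ : odd_part _ = q)//; apply/funext => n.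
  by rewrite /odd_part /= odd_double /= uphalf_double.
Qed.

Definition prod_rep := Represented prod_name_fun prod_name_surj.
End ProductSpace.

Section SequenceSpace.
Variable X : represented.

Definition seq_name (r : baire) (x : nat -> X) :=
  forall i, name X (fun n => r (npair i n)) (x i).

Lemma seq_name_fun r x y : seq_name r x -> seq_name r y -> x = y.
Proof. by move=> rx ry; apply/funext => i; exact: name_fun (rx i) (ry i). Qed.

Lemma seq_name_surj x : exists r, seq_name r x.
Proof.
have [p px] := choice (fun i => name_surj (x i)).
exists (fun n => p (nfst n) (nsnd n)) => i.
rewrite (_ : (fun n => _) = p i)//; apply/funext => n.
by rewrite npairK1 npairK2.
Qed.

Definition seq_rep := Represented seq_name_fun seq_name_surj.
End SequenceSpace.

(** For [K : X => Z], [g : Z => W], [h : X * W => Y], this says that [x] lies in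
    the domain of the composition [x |-> h (x, g (K x))] of partial multi-valued
    functions, i.e. no choice of intermediate value leaves a domain, and that all
    its values lie in [f x]. *)
Definition reduces_at X Y Z W (f : multifun X Y) (g : multifun Z W)
    (h : multifun (X * W) Y) (K : multifun X Z) (x : X) :=
  mdom K x /\
  forall z, K x z -> mdom g z /\
    forall w, g z w -> mdom h (x, w) /\ forall y, h (x, w) y -> f x y.

Definition weihrauch_le (X Y Z W : represented)
    (f : multifun X Y) (g : multifun Z W) :=
  exists (h : multifun (prod_rep X W) Y) (K : multifun X Z),
    [/\ computable_multifun h, computable_multifun K
      & forall x, mdom f x -> reduces_at f g h K x].

Definition weihrauch_equiv (X Y Z W : represented)
    (f : multifun X Y) (g : multifun Z W) :=
  weihrauch_le f g /\ weihrauch_le g f.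

Section CauchyRepresentation.
Variables (R : realType) (V : normedModType R) (a : nat -> V).

Definition cauchy_name (p : baire) (x : V) :=
  (forall i j, (i <= j)%N -> `|a (p i) - a (p j)| <= 2 ^- i) /\
  (fun n => a (p n)) @ \oo --> x.

Lemma cauchy_name_fun p x y : cauchy_name p x -> cauchy_name p y -> x = y.
Proof. by move=> [_ px] [_ py]; exact: cvg_unique px py. Qed.

Lemma cauchy_name_dist p x i : cauchy_name p x -> `|a (p i) - x| <= 2 ^- i.
Proof.
move=> [pc px].
have cv : (fun n => `|a (p i) - a (p n)|) @ \oo --> `|a (p i) - x|.
  by apply: cvg_norm; apply: cvgB => //; exact: cvg_cst.
rewrite -(cvg_lim (@Rhausdorff R) cv).
apply: limr_le; first exact: cvgP cv.
by exists i => // n /= /pc.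
Qed.

Lemma exp2Vn_lt (e : R) : 0 < e -> exists n, 2 ^- n < e.
Proof.
move=> e0; have /archi_boundP : 0 <= e^-1 by rewrite invr_ge0 ltW.
set n := Num.bound _ => en; exists n.
rewrite -[ltRHS]invrK ltf_pV2 ?posrE ?exprn_gt0 ?invr_gt0//.
by apply: lt_trans en _; rewrite -natrX ltr_nat ltn_expl.
Qed.

Lemma exp2VD n : 2 ^- n.+1 + 2 ^- n.+1 = 2 ^- n :> R.
Proof. by rewrite exprS invfM [2^-1 * _]mulrC -splitr. Qed.

Lemma cauchy_nameI p x : (forall i, `|a (p i) - x| <= 2 ^- i.+1) ->
  cauchy_name p x.
Proof.
move=> px; split=> [i j ij|].
  rewrite -(subrKA x) (le_trans (ler_normD _ _))//.
  rewrite (distrC x) -exp2VD lerD// (le_trans (px j))//.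
  by rewrite lef_pV2 ?posrE ?exprn_gt0// ler_weXn2l// ler1n.
apply/cvgrPdist_lt => e /exp2Vn_lt[n ne].
exists n => // m /= nm; rewrite distrC (le_lt_trans (px m))//.
apply: le_lt_trans ne; rewrite lef_pV2 ?posrE ?exprn_gt0//.
by rewrite ler_weXn2l ?ler1n// leqW.
Qed.

Hypothesis a_dense : dense (range a).

Lemma dense_dist (x : V) (e : R) : 0 < e -> exists i, `|a i - x| < e.
Proof.
move=> e0; have [|y [xy [i _ iy]]] := a_dense _ (open_nbhs_ball x (PosNum e0)).1.
  by exists x; exact: (open_nbhs_ball x (PosNum e0)).2.
exists i; rewrite distrC iy; move: xy => /interior_subset.
by rewrite -ball_normE.
Qed.

Lemma cauchy_name_surj x : exists p, cauchy_name p x.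
Proof.
have /choice[p px] : forall i, exists j, `|a j - x| <= 2 ^- i.+1.
  move=> i; have [|j jx] := @dense_dist x (2 ^- i.+1).
    by rewrite invr_gt0 exprn_gt0.
  by exists j; exact: ltW.
by exists p; exact: cauchy_nameI.
Qed.

Definition cauchy_rep := Represented cauchy_name_fun cauchy_name_surj.
End CauchyRepresentation.

Section RealNumbers.
Variable R : realType.

Definition rat_enum (n : nat) : R :=
  ((nfst n)%:R - (nfst (nsnd n))%:R) / (nsnd (nsnd n)).+1%:R.

Lemma rat_enum_dense : dense (range (rat_enum : nat -> R^o)).
Proof.
move=> O O0 oO; have [x [Ox [q _ qx]]] := @dense_rat R O O0 oO.
exists x; split=> //; rewrite -{}qx {O O0 oO Ox x}.
have [m [n mn]] : exists m n : nat, numq q = m%:Z - n%:Z.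
  case: (numq q) => k; [exists k, 0%N|exists 0%N, k.+1]; rewrite ?subr0//.
  by rewrite NegzE sub0r.
exists (npair m (npair n `|denq q|.-1)) => //.
rewrite /rat_enum !npairK1 !npairK2 npairK1 /ratr mn.
rewrite prednK ?absz_gt0 ?denq_eq0// rmorphB/= !pmulrn; congr (_ / _).
by rewrite absz_denq.
Qed.

Definition real_rep : represented := cauchy_rep rat_enum_dense.
End RealNumbers.

Definition seq_code (s : seq nat) : nat :=
  foldr (fun x c => (npair x c).+1) 0%N s.

Lemma seq_code_inj : injective seq_code.
Proof.
elim=> [|x s IH] [|y t]//= [e].
have := congr1 nfst e; have := congr1 nsnd e.
by rewrite !npairK1 !npairK2 => /IH -> ->.
Qed.

(** [associate_maps p q r]: the continuous partial functional with associate [p]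
    (application in Kleene's second algebra) maps [q] to [r].  To compute [r n],
    [p] is asked about longer and longer prefixes of [q] until it gives a nonzero
    answer, which is the successor of [r n]. *)
Definition associate_maps (p q r : baire) := forall n, exists k,
  p (npair n (seq_code (mkseq q k))) = (r n).+1 /\
  forall j, (j < k)%N -> p (npair n (seq_code (mkseq q j))) = 0%N.

Section FunctionSpace.
Variables (R : realType) (V W : normedModType R) (a : nat -> V) (b : nat -> W).
Hypotheses (a_dense : dense (range a)) (b_dense : dense (range b)).

Definition function_name (p : baire) (f : continuousType V W) :=
  forall q x, cauchy_name a q x ->
    exists r, associate_maps p q r /\ cauchy_name b r (f x).

Lemma associate_maps_fun p q r r' :
  associate_maps p q r -> associate_maps p q r' -> r = r'.
Proof.
move=> h h'; apply/funext => n; have [k [pk lk]] := h n.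
have [k' [pk' lk']] := h' n; case: (ltngtP k k') => kk'.
- by have := lk' _ kk'; rewrite pk.
- by have := lk _ kk'; rewrite pk'.
- by move: pk'; rewrite -kk' pk => -[].
Qed.

Lemma function_name_fun p f g : function_name p f -> function_name p g -> f = g.
Proof.
move=> pf pg; apply/continuousEP => x.
have [q qx] := cauchy_name_surj a_dense x.
have [r [pr rf]] := pf _ _ qx; have [r' [pr' rg]] := pg _ _ qx.
by apply: cauchy_name_fun rf _; rewrite (associate_maps_fun pr pr').
Qed.

Lemma function_name_surj f : exists p, function_name p f.
Proof.
pose good n s j := s != [::] :> seq nat /\ forall y,
  `|a (last 0%N s) - y| <= 2 ^- (size s).-1 -> `|b j - f y| <= 2 ^- n.+1.
have /choice[p0 p0P] : forall c : nat * seq nat, exists v,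
    (v = 0%N /\ forall j, ~ good c.1 c.2 j) \/
    (exists2 j, v = j.+1 & good c.1 c.2 j).
  move=> c; have [[j jc]|nj] := pselect (exists j, good c.1 c.2 j).
    by exists j.+1; right; exists j.
  by exists 0%N; left; split=> // j jc; apply: nj; exists j.
have /choice[p pP] : forall m, exists v, forall n s,
    m = npair n (seq_code s) -> v = p0 (n, s).
  move=> m; have [[n [s mns]]|nm] :=
      pselect (exists n s, m = npair n (seq_code s)).
    exists (p0 (n, s)) => n' s'; rewrite mns => e; congr (p0 (_, _)).
      by rewrite -(npairK1 n (seq_code s)) e npairK1.
    apply: seq_code_inj.
    by rewrite -(npairK2 n (seq_code s)) e npairK2.
  by exists 0%N => n s mns; case: nm; exists n, s.
exists p => q x qx.
have ex n : exists k, p0 (n, mkseq q k) != 0%N.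
  have e0 : 0 < 2 ^- n.+2 :> R by rewrite invr_gt0 exprn_gt0.
  have [j jfx] := dense_dist b_dense (f x) e0.
  have /cvgrPdist_lt/(_ _ e0) := @cts_fun _ _ f x.
  rewrite near_map => /nbhs_ballP[d d0 fd].
  have [k kd] : exists k, 2 ^- k < d / 2 by apply: exp2Vn_lt; rewrite divr_gt0.
  exists k.+1; apply/eqP => p00.
  have [[_ /(_ j)]|[j' e]] := p0P (n, mkseq q k.+1); last by rewrite p00 in e.
  apply; rewrite /good [(_, _).2]/= [(_, _).1]/=.
  split=> [|y]; first by rewrite mkseqS; case: mkseq.
  rewrite mkseqS last_rcons size_rcons size_mkseq => qky.
  have xy : ball x d y.
    rewrite -ball_normE /ball_/= -(subrKA (a (q k))) (le_lt_trans (ler_normD _ _))//.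
    rewrite [ltRHS]splitr ltrD//; last exact: le_lt_trans kd.
    by rewrite distrC (le_lt_trans (cauchy_name_dist k qx)).
  rewrite -(subrKA (f x)) (le_trans (ler_normD _ _))//.
  by rewrite -exp2VD lerD ?ltW//; exact: fd.
have /choice[r rP] : forall n, exists v, exists k,
    [/\ p0 (n, mkseq q k) = v.+1,
        forall j, (j < k)%N -> p0 (n, mkseq q j) = 0%N
      & `|b v - f x| <= 2 ^- n.+1].
  move=> n; case: (ex_minnP (ex n)) => k k0 kmin.
  have [[k00 _]|[j kj [/= ne gj]]] := p0P (n, mkseq q k).
    by rewrite k00 in k0.
  exists j, k; split=> // [i ik|].
    by apply/eqP/contraT => /kmin; rewrite leqNgt ik.
  case: k ne gj {k0 kmin kj} => [//|k] _; apply.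
  rewrite mkseqS last_rcons size_rcons size_mkseq.
  exact: (cauchy_name_dist k qx).
exists r; split; last by apply: cauchy_nameI => n; have [k []] := rP n.
move=> n; have [k [pk lk _]] := rP n; exists k.
rewrite (pP _ _ _ erefl); split=> // j /lk <-.
exact: (pP _ _ _ erefl).
Qed.

(** The standard (exponential) representation of the space of continuous
    functions: a name of [f] is an associate of a realizer of [f]. *)
Definition continuous_rep := Represented function_name_fun function_name_surj.
End FunctionSpace.

Definition finite_dimensional (R : realType) (V : normedModType R) :=
  exists n (v : 'I_n -> V), forall x, exists c : 'I_n -> R,
    x = \sum_(i < n) c i *: v i.

Record computable_hilbert (R : realType) := ComputableHilbert {
  hspace :> completeNormedModType R ;
  hdot : {dot hspace for idfun} ;
  hdot_norm : forall x, `|x| = Num.sqrt (hdot x x) ;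
  hseq : nat -> hspace ;
  hseq_dense : dense (range hseq) ;
  hrep := cauchy_rep hseq_dense ;
  hdist_computable : @computable_point (seq_rep (seq_rep (real_rep R)))
    (fun i j => `|hseq i - hseq j|) ;
  hadd_computable : @computable_fun (prod_rep hrep hrep) hrep
    (fun z => z.1 + z.2) ;
  hscale_computable : @computable_fun (prod_rep (real_rep R) hrep) hrep
    (fun z => z.1 *: z.2) ;
  hdot_computable : @computable_fun (prod_rep hrep hrep) (real_rep R)
    (fun z => hdot z.1 z.2) }.

Arguments hdot {R} H : rename.
Arguments hrep {R} H : rename.

Definition MCT (R : realType) : multifun (seq_rep (real_rep R)) (real_rep R) :=
  fun x s => [/\ nondecreasing_seq x, has_ubound (range x) & s = sup (range x)].

Section FrechetRiesz.
Variables (R : realType) (H : computable_hilbert R).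

Definition unit_ball_values (f : H -> R) : set R :=
  [set `|f x| | x in [set x : H | `|x| <= 1]].

Definition functional_norm (f : H -> R) : R := sup (unit_ball_values f).

Definition bounded_linear (f : H -> R) :=
  scalar f /\ has_ubound (unit_ball_values f).

Definition continuous_real_rep : represented :=
  continuous_rep (@hseq_dense R H) (@rat_enum_dense R).

Definition FRR : multifun continuous_real_rep (hrep H) :=
  fun f y => bounded_linear f /\ forall x, f x = hdot H x y.
End FrechetRiesz.

(* Main.v *)
Require Import Defs.
From HB Require Import structures.
From mathcomp Require Import all_boot all_order all_algebra.
From mathcomp Require Import all_classical all_reals all_analysis.
From mathcomp Require Import ring lra zify.

Set Implicit Arguments.
Unset Strict Implicit.
Unset Printing Implicit Defensive.

Import Order.TTheory GRing.Theory Num.Theory.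
Import numFieldNormedType.Exports.

Local Open Scope classical_set_scope.
Local Open Scope ring_scope.

(** FRR <= MCT: if [f = <., y>] then [2 f x - |x|^2 = |y|^2 - |x - y|^2], so rational
    lower bounds of the left-hand side on the dense sequence [a] yield an increasing
    sequence with supremum [|y|^2]. Once [|y|^2] is known, a point [a i] close to [y]
    is found by searching for a large value of [2 f (a i) - |a i|^2].

    MCT <= FRR: search in the dense sequence for vectors [e k] of norm about [1] that
    are almost orthogonal to one another and to the [a i] with [i < k]. For
    [j = (n, l)], let [m_j] be the first [m] at which [x m > x n + 5 * 2 ^- l] is
    certified, and let [y] be the sum of the [2 ^- j *: e m_j] over the [j] for which
    [m_j] exists. Whether [m_j] exists is only semi-decidable, but [<a i, e m>] is
    small for [m > i], so [<a i, y>], hence [<., y>], is computable. Conversely, if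
    [a i] is close to [y] relative to [2 ^- j], then [m_j < i + j + 5]: otherwise
    [<y, e m_j>] would be both about [2 ^- j] and much smaller. So [y] tells how far
    to look in order to find, for given [l], an [n] after which [x] rises by little. *)

(** * Computable functionals *)

(** One program must serve every oracle in [D], and nothing is asked of it elsewhere. So [D] can be
    a set of valid names, and [F] may take arbitrary values at oracles where a search would
    diverge. *)
Definition computable_on (D : set baire) (F : baire -> nat -> nat) :=
  exists c, forall p n, D p -> sem p c n (F p n).

Lemma computable_onP D F : computable_on D F ->
  exists c, forall p, D p -> computes c p (F p).
Proof. by move=> [c cF]; exists c => p Dp n; exact: cF. Qed.

Section Closure.
Variable D : set baire.
Implicit Types F G : baire -> nat -> nat.
Local Notation comp := (computable_on D).

Lemma computable_ext F G : (forall p n, D p -> F p n = G p n) -> comp F -> comp G.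
Proof. by move=> FG [c cF]; exists c => p n Dp; rewrite -FG//; exact: cF. Qed.

Lemma computable_id : comp (fun _ n => n).
Proof.
by exists (Pair Fst Snd) => p n _; exists (nfst n), (nsnd n); rewrite npair_fst_snd.
Qed.

Lemma computable_app F G : comp F -> comp G -> comp (fun p n => F p (G p n)).
Proof.
move=> [c cF] [d dG]; exists (Comp c d) => p n Dp.
by exists (G p n); [exact: dG|exact: cF].
Qed.

Lemma computable_oracle F : comp F -> comp (fun p n => p (F p n)).
Proof. by apply: (@computable_app (fun p n => p n)); exists Oracle. Qed.

Lemma computable_succ F : comp F -> comp (fun p n => (F p n).+1).
Proof. by apply: (@computable_app (fun p n => n.+1)); exists Succ. Qed.

Lemma computable_nfst F : comp F -> comp (fun p n => nfst (F p n)).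
Proof. by apply: (@computable_app (fun p n => nfst n)); exists Fst. Qed.

Lemma computable_nsnd F : comp F -> comp (fun p n => nsnd (F p n)).
Proof. by apply: (@computable_app (fun p n => nsnd n)); exists Snd. Qed.

Lemma computable_const k : comp (fun _ _ => k).
Proof. by elim: k => [|k]; [exists Zero|exact: computable_succ]. Qed.

Lemma computable_npair F G : comp F -> comp G ->
  comp (fun p n => npair (F p n) (G p n)).
Proof.
move=> [c cF] [d dG]; exists (Pair c d) => p n Dp.
by exists (F p n), (G p n); split; [exact: cF|exact: dG|].
Qed.

Lemma computable_app2 (F : baire -> nat -> nat -> nat) G G' :
  comp (fun p z => F p (nfst z) (nsnd z)) -> comp G -> comp G' ->
  comp (fun p n => F p (G p n) (G' p n)).
Proof.
move=> cF cG cG'; have := computable_app cF (computable_npair cG cG').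
by apply: computable_ext => p n _; rewrite npairK1 npairK2.
Qed.

Lemma computable_app3 (F : baire -> nat -> nat -> nat -> nat) G G' G'' :
  comp (fun p z => F p (nfst z) (nfst (nsnd z)) (nsnd (nsnd z))) ->
  comp G -> comp G' -> comp G'' ->
  comp (fun p n => F p (G p n) (G' p n) (G'' p n)).
Proof.
move=> cF cG cG' cG''.
have := computable_app cF (computable_npair cG (computable_npair cG' cG'')).
by apply: computable_ext => p n _; rewrite !(npairK1, npairK2).
Qed.

Lemma computable_iteri (S : baire -> nat -> nat -> nat -> nat) F G :
  comp F -> comp (fun p z => S p (nfst z) (nfst (nsnd z)) (nsnd (nsnd z))) ->
  comp G -> comp (fun p n => iteri (G p n) (S p n) (F p n)).
Proof.
move=> [c cF] [d dS] cG.
suff : comp (fun p z => iteri (nsnd z) (S p (nfst z)) (F p (nfst z))).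
  move=> h; have := computable_app h (computable_npair computable_id cG).
  by apply: computable_ext => p n _; rewrite npairK1 npairK2.
exists (Rec c d) => p n Dp.
exists (fun k => iteri k (S p (nfst n)) (F p (nfst n))); split=> // [|k _].
  exact: cF.
have := dS p (npair (nfst n) (npair k (iteri k (S p (nfst n)) (F p (nfst n))))) Dp.
by rewrite !(npairK1, npairK2).
Qed.

Lemma computable_pred F : comp F -> comp (fun p n => (F p n).-1).
Proof.
apply: (@computable_app (fun p n => n.-1)).
(* The step forgets the accumulator and returns the counter, whose last value is [n.-1]. *)
apply: (@computable_ext (fun p n => iteri n (fun k _ => k) 0%N)).
  by move=> p [].
apply: computable_iteri; [exact: computable_const| |exact: computable_id].
by do 2?[apply: computable_nfst|apply: computable_nsnd]; exact: computable_id.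
Qed.

Lemma computable_addn F G : comp F -> comp G -> comp (fun p n => F p n + G p n)%N.
Proof.
move=> cF cG.
apply: (@computable_ext (fun p n => iteri (G p n) (fun _ s => s.+1) (F p n))).
  by move=> p n _; elim: (G p n) => [|k /= ->]; rewrite ?addn0 ?addnS.
apply: computable_iteri => //.
by do !apply: computable_succ; do !apply: computable_nsnd; exact: computable_id.
Qed.

Lemma computable_muln F G : comp F -> comp G -> comp (fun p n => F p n * G p n)%N.
Proof.
move=> cF cG.
apply: (@computable_ext (fun p n => iteri (G p n) (fun _ s => F p n + s)%N 0%N)).
  by move=> p n _; elim: (G p n) => [|k /= ->]; rewrite ?muln0 ?mulnS.
apply: (@computable_iteri (fun p n _ s => F p n + s)%N) => //.
  exact: computable_const.
apply: computable_addn; last by do !apply: computable_nsnd; exact: computable_id.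
by apply: computable_app => //; apply: computable_nfst; exact: computable_id.
Qed.

Lemma computable_subn F G : comp F -> comp G -> comp (fun p n => F p n - G p n)%N.
Proof.
move=> cF cG.
apply: (@computable_ext (fun p n => iteri (G p n) (fun _ s => s.-1) (F p n))).
  by move=> p n _; elim: (G p n) => [|k /= ->]; rewrite ?subn0 ?subnS.
apply: computable_iteri => //.
by apply: computable_pred; do !apply: computable_nsnd; exact: computable_id.
Qed.

Lemma computable_exp2 F : comp F -> comp (fun p n => 2 ^ F p n)%N.
Proof.
move=> cF; apply: (@computable_ext (fun p n => iteri (F p n) (fun _ s => s + s)%N 1%N)).
  by move=> p n _; elim: (F p n) => [|k /= ->]; rewrite ?expnS ?addnn ?mul2n.
apply: computable_iteri => //; first exact: computable_const.
by apply: computable_addn; do !apply: computable_nsnd; exact: computable_id.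
Qed.

Lemma computable_if (b : baire -> nat -> bool) F G :
  comp (fun p n => b p n) -> comp F -> comp G ->
  comp (fun p n => if b p n then F p n else G p n).
Proof.
move=> cb cF cG.
apply: (@computable_ext (fun p n => b p n * F p n + (1 - b p n) * G p n)%N).
  by move=> p n _; case: (b p n); rewrite ?(mul1n, mul0n) ?addn0.
apply: computable_addn; apply: computable_muln => //.
by apply: computable_subn => //; exact: computable_const.
Qed.

Lemma computable_leq F G : comp F -> comp G -> comp (fun p n => (F p n <= G p n)%N).
Proof.
move=> cF cG; apply: (@computable_ext (fun p n => 1 - (F p n - G p n))%N).
  by move=> p n _; rewrite -subn_eq0; case: (F p n - G p n)%N.
apply: computable_subn; first exact: computable_const.
exact: computable_subn.
Qed.

Lemma computable_negb (b : baire -> nat -> bool) :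
  comp (fun p n => b p n) -> comp (fun p n => ~~ b p n).
Proof.
move=> cb; apply: (@computable_ext (fun p n => 1 - b p n)%N).
  by move=> p n _; case: (b p n).
by apply: computable_subn => //; exact: computable_const.
Qed.

Lemma computable_andb (b b' : baire -> nat -> bool) :
  comp (fun p n => b p n) -> comp (fun p n => b' p n) ->
  comp (fun p n => b p n && b' p n).
Proof.
move=> cb cb'; apply: (@computable_ext (fun p n => b p n * b' p n)%N).
  by move=> p n _; case: (b p n); case: (b' p n).
exact: computable_muln.
Qed.

Lemma computable_eqn F G : comp F -> comp G -> comp (fun p n => F p n == G p n).
Proof.
move=> cF cG.
apply: (@computable_ext (fun p n => (F p n <= G p n) && (G p n <= F p n))%N).
  by move=> p n _; rewrite eqn_leq.
by apply: computable_andb; exact: computable_leq.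
Qed.

Lemma computable_odd F : comp F -> comp (fun p n => odd (F p n)).
Proof.
move=> cF; apply: (@computable_ext (fun p n => iteri (F p n) (fun _ s => 1 - s)%N 0%N)).
  by move=> p n _; elim: (F p n) => [|k /= ->]//; case: (odd k).
apply: computable_iteri => //; first exact: computable_const.
apply: computable_subn; first exact: computable_const.
by do !apply: computable_nsnd; exact: computable_id.
Qed.

Lemma computable_double F : comp F -> comp (fun p n => (F p n).*2).
Proof.
move=> cF; apply: (@computable_ext (fun p n => F p n + F p n)%N).
  by move=> p n _; rewrite addnn.
exact: computable_addn.
Qed.

End Closure.

Create HintDb comp.
#[local] Hint Resolve computable_id computable_const computable_oracle
  computable_succ computable_nfst computable_nsnd computable_npair computable_pred
  computable_addn computable_muln computable_subn computable_exp2 computable_if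
  computable_leq computable_negb computable_andb computable_eqn computable_odd
  computable_double : comp.
#[local] Hint Constants Opaque : comp.

(** The least solution of [P], or [0] if there is none. *)
Definition mu (P : pred nat) : nat :=
  if pselect (exists n, P n) is left h then ex_minn h else 0%N.

Lemma mu_ex (P : pred nat) : (exists n, P n) -> P (mu P).
Proof. by rewrite /mu; case: pselect => // h _; case: ex_minnP. Qed.

Lemma mu_min (P : pred nat) n : P n -> (mu P <= n)%N.
Proof. by rewrite /mu; case: pselect => // h Pn; case: ex_minnP => m _; apply. Qed.

Lemma computable_mu D (P : baire -> nat -> pred nat) :
  (forall p n, D p -> exists k, P p n k) ->
  computable_on D (fun p z => P p (nfst z) (nsnd z)) ->
  computable_on D (fun p n => mu (P p n)).
Proof.
(* [Mu] stops at the first zero, so it is run on the negated predicate, which takes the value [1] at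
   all earlier arguments. *)
move=> exP cP; have [c cnP] := computable_negb cP.
exists (Mu c) => p n Dp; split=> [|k kn].
  by have := cnP p (npair n (mu (P p n))) Dp; rewrite npairK1 npairK2 mu_ex//; exact: exP.
exists 0%N; have := cnP p (npair n k) Dp; rewrite npairK1 npairK2.
by rewrite (_ : P p n k = false)//; apply: contraTF kn => /mu_min; rewrite -leqNgt.
Qed.

(** The least [k < n] with [P k], or [n] if there is none. *)
Definition first_below (P : pred nat) (n : nat) : nat :=
  iteri n (fun k s => if (s == k) && ~~ P k then k.+1 else s) 0%N.

Lemma first_below_spec (P : pred nat) n :
  [/\ (first_below P n <= n)%N,
      (first_below P n < n)%N -> P (first_below P n)
    & forall k, (k < first_below P n)%N -> ~~ P k].
Proof.
elim: n => [|n [le lt min]] //=; rewrite -/(first_below P n).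
case: eqVneq => [e|ne] /=; last first.
  have lt' : (first_below P n < n)%N by rewrite ltn_neqAle ne.
  by split=> // [|_]; [exact: leqW|exact: lt].
case: (boolP (P n)) => /= Pn; first by rewrite {1 2}e; split=> // _; rewrite e.
split=> // [|k]; first by rewrite ltnn.
by rewrite ltnS leq_eqVlt => /predU1P[-> //|kn]; apply: min; rewrite e.
Qed.

Lemma first_below_mu (P : pred nat) n :
  (first_below P n < n)%N -> first_below P n = mu P.
Proof.
have [_ lt min] := first_below_spec P n; move=> /lt Pf.
apply/eqP; rewrite eqn_leq mu_min// andbT leqNgt; apply/negP => /min.
by rewrite mu_ex//; exists (first_below P n).
Qed.

Lemma first_below_all (P : pred nat) n k :
  (n <= first_below P n)%N -> (k < n)%N -> ~~ P k.
Proof.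
by have [_ _ min] := first_below_spec P n => le kn; apply: min; exact: leq_trans le.
Qed.

Lemma computable_first_below D (P : baire -> nat -> pred nat) F :
  computable_on D (fun p z => P p (nfst z) (nsnd z)) -> computable_on D F ->
  computable_on D (fun p n => first_below (P p n) (F p n)).
Proof.
move=> cP cF.
apply: (@computable_iteri _
  (fun p n k s => if (s == k) && ~~ P p n k then k.+1 else s)) => //.
  exact: computable_const.
have c1 := computable_nfst (computable_id D).
have c2 := computable_nsnd (computable_id D).
have c21 := computable_nfst c2; have c22 := computable_nsnd c2.
apply: computable_if => //; last exact: computable_succ.
apply: computable_andb; first exact: computable_eqn.
apply: computable_negb.
exact: (@computable_app2 _ (fun p n k => nat_of_bool (P p n k))).
Qed.

(** [relativize g c] runs [c] on the second component of its input, answering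
    oracle queries [m] by [g] on [npair i m], where [i] is the first component. *)
Fixpoint relativize (g c : Defs.code) : Defs.code :=
  match c with
  | Zero => Zero
  | Succ => Comp Succ Snd
  | Fst => Comp Fst Snd
  | Snd => Comp Snd Snd
  | Oracle => g
  | Pair c1 c2 => Pair (relativize g c1) (relativize g c2)
  | Comp c1 c2 => Comp (relativize g c1) (Pair Fst (relativize g c2))
  | Rec c1 c2 =>
      Comp (Rec (relativize g c1)
             (Comp (relativize g c2)
                (Pair (Comp Fst Fst) (Pair (Comp Snd Fst) Snd))))
        (Pair (Pair Fst (Comp Fst Snd)) (Comp Snd Snd))
  | Mu c1 => Mu (Comp (relativize g c1)
                   (Pair (Comp Fst Fst) (Pair (Comp Snd Fst) Snd)))
  end.

Lemma relativizeP g c p q i n y :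
  (forall m, sem p g (npair i m) (q m)) -> sem q c n y ->
  sem p (relativize g c) (npair i n) y.
Proof.
move=> gq.
(* [Rec] and [Mu] extend their input on the right to [((i, m), k)], while the relativized body
   expects [(i, (m, k))]. *)
have shuffle d m k v : sem p d (npair i (npair m k)) v ->
    sem p (Comp d (Pair (Comp Fst Fst) (Pair (Comp Snd Fst) Snd)))
      (npair (npair i m) k) v.
  move=> dv; exists (npair i (npair m k)) => //=.
  exists i, (npair m k); split=> //.
    by exists (npair i m); rewrite !npairK1.
  exists m, k; split=> //; last by rewrite npairK2.
  by exists (npair i m); rewrite ?npairK1 ?npairK2.
elim: c n y => /= [||||| c1 IH1 c2 IH2| c1 IH1 c2 IH2| c1 IH1 c2 IH2| c1 IH1] n y.
- by [].
- by move=> ->; exists n; rewrite ?npairK2.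
- by move=> ->; exists n; rewrite ?npairK2.
- by move=> ->; exists n; rewrite ?npairK2.
- by move=> ->; exact: gq.
- by move=> [u [v [u1 v2 ->]]]; exists u, v; split; [exact: IH1|exact: IH2|].
- move=> [u u2 uy]; exists (npair i u); last exact: IH1.
  by exists i, u; split=> //; [rewrite npairK1|exact: IH2].
- move=> [s [s0 sS ->]]; exists (npair (npair i (nfst n)) (nsnd n)).
    exists (npair i (nfst n)), (nsnd n); split=> //.
      exists i, (nfst n); split=> //; first by rewrite npairK1.
      by exists n; rewrite ?npairK2.
    by exists n; rewrite ?npairK2.
  exists s; rewrite npairK1 npairK2; split=> // [|k kn]; first exact: IH1.
  by apply: shuffle; apply: IH2; exact: sS.
- move=> [y0 yS]; split; first by apply: shuffle; exact: IH1.
  move=> k ky; have [v cv] := yS k ky.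
  by exists v; apply: shuffle; exact: IH1.
Qed.

(** This composes a program with an oracle that is itself computed, uniformly in a parameter [i],
    from the given oracle. *)
Lemma computable_relative D c (Q : baire -> nat -> baire)
    (F : baire -> nat -> nat -> nat) :
  (forall p i, D p -> computes c (Q p i) (F p i)) ->
  computable_on D (fun p z => Q p (nfst z) (nsnd z)) ->
  computable_on D (fun p z => F p (nfst z) (nsnd z)).
Proof.
move=> cF [g gQ]; exists (relativize g c) => p n Dp.
rewrite -{1}(npair_fst_snd n); apply: (relativizeP (q := Q p (nfst n))).
  by move=> m; have := gQ p (npair (nfst n) m) Dp; rewrite npairK1 npairK2.
exact: cF.
Qed.

(** * Arithmetic of rational codes *)

Definition rat_code (m n d : nat) : nat := npair m (npair n d.-1).
Definition rat_pos (u : nat) : nat := nfst u.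
Definition rat_neg (u : nat) : nat := nfst (nsnd u).
Definition rat_den (u : nat) : nat := (nsnd (nsnd u)).+1.

Definition rat_add u v := rat_code
  (rat_pos u * rat_den v + rat_pos v * rat_den u)
  (rat_neg u * rat_den v + rat_neg v * rat_den u) (rat_den u * rat_den v).
Definition rat_opp u := rat_code (rat_neg u) (rat_pos u) (rat_den u).
Definition rat_scale l u := rat_code (rat_pos u) (rat_neg u) (rat_den u * 2 ^ l).
Definition rat_nat k := rat_code k 0 1.
(** Cross-multiplication with the negative parts moved to the other side, so that only addition and
    multiplication of naturals occur. *)
Definition rat_le u v :=
  (rat_pos u * rat_den v + rat_neg v * rat_den u <=
   rat_pos v * rat_den u + rat_neg u * rat_den v)%N.

Section RationalCodes.
Variable R : realType.
Local Notation q := (rat_enum R).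

Lemma rat_enumE u : q u = ((rat_pos u)%:R - (rat_neg u)%:R) / (rat_den u)%:R.
Proof. by []. Qed.

Lemma rat_den_gt0 u : 0 < (rat_den u)%:R :> R.
Proof. by rewrite ltr0n. Qed.

Lemma rat_codeE m n d : (0 < d)%N -> q (rat_code m n d) = (m%:R - n%:R) / d%:R.
Proof. by move=> d0; rewrite /rat_enum /rat_code !(npairK1, npairK2) prednK. Qed.

Lemma rat_addE u v : q (rat_add u v) = q u + q v.
Proof.
rewrite rat_codeE ?muln_gt0// !rat_enumE !natrD !natrM.
by have := rat_den_gt0 u; have := rat_den_gt0 v => v0 u0; field; rewrite !gt_eqF.
Qed.

Lemma rat_oppE u : q (rat_opp u) = - q u.
Proof. by rewrite rat_codeE// rat_enumE -mulNr opprB. Qed.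

Lemma rat_scaleE l u : q (rat_scale l u) = 2 ^- l * q u.
Proof.
rewrite rat_codeE ?muln_gt0 ?expn_gt0// rat_enumE natrM natrX invfM.
by rewrite mulrA mulrC.
Qed.

Lemma rat_natE k : q (rat_nat k) = k%:R.
Proof. by rewrite rat_codeE// subr0 divr1. Qed.

Lemma rat_leE u v : rat_le u v = (q u <= q v).
Proof.
rewrite /rat_le !rat_enumE ler_pdivrMr ?rat_den_gt0// mulrAC.
rewrite ler_pdivlMr ?rat_den_gt0// -(ler_nat R) !natrD !natrM.
by rewrite !mulrBl lerBlDr addrAC lerBrDr.
Qed.

(** A natural upper bound read off the code; it serves to bound [|a i|] computably. *)
Lemma rat_le_pos u : q u <= (rat_pos u)%:R.
Proof.
rewrite rat_enumE ler_pdivrMr ?rat_den_gt0// (@le_trans _ _ (rat_pos u)%:R)//.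
  by rewrite lerBlDr lerDl.
by rewrite -natrM ler_nat leq_pmulr.
Qed.

Lemma real_name_dist p x i : name (real_rep R) p x -> `|q (p i) - x| <= 2 ^- i.
Proof. by move=> px; exact: (cauchy_name_dist i px). Qed.

Lemma real_nameI p x : (forall i, `|q (p i) - x| <= 2 ^- i.+1) ->
  name (real_rep R) p x.
Proof. exact: cauchy_nameI. Qed.

Lemma real_name_cst i : name (real_rep R) (fun=> i) (q i).
Proof. by apply: real_nameI => j; rewrite subrr normr0 invr_ge0 exprn_ge0. Qed.

End RationalCodes.

Section RationalCodesComputable.
Variable D : set baire.
Implicit Types F G : baire -> nat -> nat.
Local Notation comp := (computable_on D).

Lemma computable_rat_add F G : comp F -> comp G ->
  comp (fun p n => rat_add (F p n) (G p n)).
Proof.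
apply: (@computable_app2 _ (fun _ => rat_add)).
by rewrite /rat_add /rat_code /rat_pos /rat_neg /rat_den; eauto 100 with comp.
Qed.

Lemma computable_rat_opp F : comp F -> comp (fun p n => rat_opp (F p n)).
Proof.
by rewrite /rat_opp /rat_code /rat_pos /rat_neg /rat_den; eauto 100 with comp.
Qed.

Lemma computable_rat_scale F G : comp F -> comp G ->
  comp (fun p n => rat_scale (F p n) (G p n)).
Proof.
by rewrite /rat_scale /rat_code /rat_pos /rat_neg /rat_den; eauto 100 with comp.
Qed.

Lemma computable_rat_nat F : comp F -> comp (fun p n => rat_nat (F p n)).
Proof. by rewrite /rat_nat /rat_code; eauto 100 with comp. Qed.

Lemma computable_rat_le F G : comp F -> comp G ->
  comp (fun p n => rat_le (F p n) (G p n)).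
Proof.
apply: (@computable_app2 _ (fun _ u v => nat_of_bool (rat_le u v))).
by rewrite /rat_le /rat_pos /rat_neg /rat_den; eauto 100 with comp.
Qed.

End RationalCodesComputable.

#[local] Hint Resolve computable_rat_add computable_rat_opp computable_rat_scale
  computable_rat_nat computable_rat_le : comp.

(** * Powers of two and fast converging sequences *)

Section Exp2.
Variable R : realType.

Lemma exp2V_gt0 n : 0 < 2 ^- n :> R.
Proof. by rewrite invr_gt0 exprn_gt0. Qed.

Lemma exp2V_ge0 n : 0 <= 2 ^- n :> R.
Proof. exact/ltW/exp2V_gt0. Qed.

Lemma exp2VS n : 2 ^- n = 2 * 2 ^- n.+1 :> R.
Proof. by rewrite -exp2VD mulr_natl mulr2n. Qed.

Lemma ler_exp2V m n : (m <= n)%N -> 2 ^- n <= 2 ^- m :> R.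
Proof. by move=> mn; rewrite lef_pV2 ?posrE ?exprn_gt0// ler_weXn2l// ler1n. Qed.

Lemma exp2V_le1 n : 2 ^- n <= 1 :> R.
Proof. by have := ler_exp2V (leq0n n); rewrite expr0 invr1. Qed.

(** Hence a factor [n] in an error estimate is absorbed by [n] further bits of precision. *)
Lemma natr_exp2V n : n%:R * 2 ^- n <= 1 :> R.
Proof.
rewrite -ler_pdivlMr ?exp2V_gt0// div1r invrK -natrX ler_nat.
exact/ltnW/ltn_expl.
Qed.

Lemma sum_exp2V n : \sum_(i < n) 2 ^- i = 2 - 2 * 2 ^- n :> R.
Proof.
elim: n => [|n IH]; first by rewrite big_ord0 expr0 invr1 mulr1 subrr.
by rewrite big_ord_recr IH /= (exp2VS n); ring.
Qed.

Lemma sum_exp2V_le n : \sum_(i < n) 2 ^- i <= 2 :> R.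
Proof. by rewrite sum_exp2V gerBl mulr_ge0// exp2V_ge0. Qed.

Lemma le_eps_exp2 (x y C : R) : 0 <= C -> (forall n, x <= y + C * 2 ^- n) -> x <= y.
Proof.
move=> C0 xy; apply/ler_addgt0Pr => e e0.
have [|n ne] := @exp2Vn_lt R (e / (C + 1)); first by rewrite divr_gt0// ltr_wpDl.
apply: le_trans (xy n) _; rewrite lerD2l.
move: ne; rewrite ltr_pdivlMr ?ltr_wpDl// => /ltW; apply: le_trans.
by rewrite mulrC ler_wpM2l ?exp2V_ge0// lerDl.
Qed.

Lemma fast_cauchy_cvg (V : completeNormedModType R) (u : nat -> V) (C : R) :
  (forall i j, (i <= j)%N -> `|u i - u j| <= C * 2 ^- i) ->
  exists2 l, u @ \oo --> l & forall i, `|u i - l| <= C * 2 ^- i.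
Proof.
move=> uC.
have C0 : 0 <= C by have := uC 0%N 0%N isT; rewrite subrr normr0 expr0 invr1 mulr1.
have cu : cvg (u @ \oo).
  suff : cauchy_ex (u @ \oo) by move=> /cauchy_exP; exact: cauchy_cvg.
  move=> e e0.
  have [|n ne] := @exp2Vn_lt R (e / (C + 1)); first by rewrite divr_gt0// ltr_wpDl.
  exists (u n), n => // m nm; rewrite -ball_normE /ball_/=.
  apply: le_lt_trans (uC _ _ nm) _.
  move: ne; rewrite ltr_pdivlMr ?ltr_wpDl//; apply: le_lt_trans.
  by rewrite mulrC ler_wpM2l ?exp2V_ge0// lerDl.
exists (lim (u @ \oo)) => // i.
have cv : (fun n => `|u i - u n|) @ \oo --> `|u i - lim (u @ \oo)|.
  by apply: cvg_norm; apply: cvgB => //; exact: cvg_cst.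
rewrite -(cvg_lim (@Rhausdorff R) cv).
apply: limr_le; first exact: cvgP cv.
by exists i => // n /= /uC.
Qed.

End Exp2.

(** * Inner products and the Riesz representation *)

Section InnerProduct.
Variables (R : realType) (H : computable_hilbert R).
Implicit Types (x y z : H) (t : R).
Local Notation "''[' x , y ]" := (hdot H x y) : ring_scope.

Lemma dotC x y : '[x, y] = '[y, x].
Proof. by rewrite (@hermitian_subproof _ _ _ _ (hdot H) x y) expr0 mul1r. Qed.

Lemma dotDr x y z : '[x, y + z] = '[x, y] + '[x, z].
Proof. exact: linearDr. Qed.

Lemma dotZr t x y : '[x, t *: y] = t * '[x, y].
Proof. exact: linearZr_LR. Qed.

Lemma dotDl x y z : '[y + z, x] = '[y, x] + '[z, x].
Proof. by rewrite !(dotC _ x) dotDr. Qed.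

Lemma dotZl t x y : '[t *: y, x] = t * '[y, x].
Proof. by rewrite !(dotC _ x) dotZr. Qed.

Lemma dotNr x y : '[x, - y] = - '[x, y].
Proof. by rewrite -scaleN1r dotZr mulN1r. Qed.

Lemma dotNl x y : '[- y, x] = - '[y, x].
Proof. by rewrite !(dotC _ x) dotNr. Qed.

Lemma dotBr x y z : '[x, y - z] = '[x, y] - '[x, z].
Proof. by rewrite dotDr dotNr. Qed.

Lemma dotBl x y z : '[y - z, x] = '[y, x] - '[z, x].
Proof. by rewrite dotDl dotNl. Qed.

Lemma dot0r x : '[x, 0] = 0.
Proof. by rewrite -(scale0r 0) dotZr mul0r. Qed.

Lemma dot0l x : '[0, x] = 0.
Proof. by rewrite dotC dot0r. Qed.

Lemma dot_sumr (I : finType) (v : I -> H) x :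
  '[x, \sum_i v i] = \sum_i '[x, v i].
Proof. by apply: (big_morph _ (dotDr x) (dot0r x)). Qed.

Lemma dot_suml (I : finType) (v : I -> H) x :
  '[\sum_i v i, x] = \sum_i '[v i, x].
Proof. by rewrite dotC dot_sumr; apply: eq_bigr => i _; rewrite dotC. Qed.

Lemma dotxx x : '[x, x] = `|x| ^+ 2.
Proof.
rewrite (hdot_norm x) sqr_sqrtr//; have [->|x0] := eqVneq x 0.
  by rewrite dot0r.
exact: ltW (@neq0_dnorm_gt0 _ _ _ (hdot H) _ x0).
Qed.

Lemma dot_sqrB x y : `|x - y| ^+ 2 = `|x| ^+ 2 - 2 * '[x, y] + `|y| ^+ 2.
Proof. by rewrite -!dotxx !(dotBl, dotBr) (dotC y x); ring. Qed.

Lemma dot_sqrDZ x y t :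
  `|x + t *: y| ^+ 2 = `|x| ^+ 2 + 2 * t * '[x, y] + t ^+ 2 * `|y| ^+ 2.
Proof. by rewrite -!dotxx !(dotDl, dotDr, dotZl, dotZr) (dotC y x); ring. Qed.

Lemma cauchy_schwarz x y : `|'[x, y]| <= `|x| * `|y|.
Proof.
have [->|y0] := eqVneq y 0; first by rewrite dot0r !normr0 mulr0.
have ny : 0 < `|y| by rewrite normr_gt0.
(* The vector is [x] minus its orthogonal projection on [y]. *)
have := sqr_ge0 `|x + (- ('[x, y] / `|y| ^+ 2)) *: y|.
rewrite dot_sqrDZ.
have -> : `|x| ^+ 2 + 2 * - ('[x, y] / `|y| ^+ 2) * '[x, y] +
    (- ('[x, y] / `|y| ^+ 2)) ^+ 2 * `|y| ^+ 2 =
    `|x| ^+ 2 - '[x, y] ^+ 2 / `|y| ^+ 2 by field; rewrite gt_eqF.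
rewrite subr_ge0 ler_pdivrMr ?exprn_gt0// -exprMn -real_normK ?num_real//.
by rewrite ler_pXn2r// nnegrE mulr_ge0.
Qed.

Lemma dot_eq x y : (forall z, '[z, x] = '[z, y]) -> x = y.
Proof.
move=> xy; apply/eqP; rewrite -subr_eq0 -normr_eq0 -sqrf_eq0 -dotxx.
by rewrite dotBr xy subrr.
Qed.

Lemma dot_continuous y : continuous (fun x => '[x, y] : R^o).
Proof.
move=> x; apply/cvgrPdist_lt => e e0.
have d0 : 0 < e / (`|y| + 1) by rewrite divr_gt0// ltr_wpDl.
near=> z; rewrite -dotBl; apply: le_lt_trans (cauchy_schwarz _ _) _.
have : `|x - z| < e / (`|y| + 1).
  by near: z; apply: (@cvgr_dist_lt _ _ _ _ _ id x) => //; exact: cvg_id.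
rewrite ltr_pdivlMr ?ltr_wpDl//; apply: le_lt_trans.
by rewrite ler_wpM2l// lerDl.
Unshelve. all: by end_near. Qed.

Lemma dot_cvgl (u : nat -> H) x y : u @ \oo --> x ->
  (fun n => '[u n, y] : R^o) @ \oo --> '[x, y].
Proof.
move=> ux.
exact: (@cvg_comp _ _ _ u (fun z => '[z, y] : R^o) _ _ _ ux (@dot_continuous y x)).
Qed.

Lemma bounded_linear_le (f : H -> R) : bounded_linear f ->
  exists2 C, 0 <= C & forall x, `|f x| <= C * `|x|.
Proof.
move=> [lf [C fC]]; exists C.
  by apply: le_trans (fC `|f 0| _); rewrite ?normr_ge0//; exists 0; rewrite /= ?normr0.
have fZ t x : f (t *: x) = t * f x.
  have f0 : f 0 = 0 by have := lf (-1) 0 0; rewrite scaler0 addr0 mulN1r addNr.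
  by have := lf t x 0; rewrite !addr0 f0 addr0.
move=> x; have [->|x0] := eqVneq x 0.
  by rewrite normr0 mulr0 -(scale0r 0) fZ mul0r normr0.
have nx : 0 < `|x| by rewrite normr_gt0.
rewrite -ler_pdivrMr//; apply: fC; exists (`|x|^-1 *: x).
  by rewrite /= normrZ ger0_norm ?invr_ge0// mulVf// gt_eqF.
by rewrite fZ normrM ger0_norm ?invr_ge0// mulrC.
Qed.

(** The minimisers of [|x|^2 - 2 f x] are the solutions of [f = <., y>], and by the
    parallelogram identity minimising sequences converge. *)
Lemma riesz (f : H -> R) : bounded_linear f -> exists y, forall x, f x = '[x, y].
Proof.
move=> bf; have [C C0 fC] := bounded_linear_le bf; have [lf _] := bf.
pose J x := `|x| ^+ 2 - 2 * f x.
have fDZ x t y : f (x + t *: y) = f x + t * f y by rewrite addrC lf addrC.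
have fZ t x : f (t *: x) = t * f x.
  have f0 : f 0 = 0 by have := fDZ 0 1 0; rewrite scaler0 addr0; lra.
  by rewrite -[t *: x]add0r fDZ f0 add0r.
(* Completing the square: [J x >= |x|^2 - 2 C |x| >= - C^2]. *)
have JC x : - C ^+ 2 <= J x.
  have := fC x; rewrite ler_norml => /andP[_ fx]; rewrite /J.
  have := sqr_ge0 (`|x| - C); rewrite sqrrB => h; nra.
have hJ : has_inf (range J).
  by split; [exists (J 0), 0|exists (- C ^+ 2) => _ [x _ <-]].
set m := inf (range J).
have mJ x : m <= J x by apply: (inf_lbound hJ.2); exists x.
(* The gap is squared because [J] controls squared distances: comparing [u i] and [u j] with their
   midpoint gives [|u i - u j|^2 <= 4 (2 ^- i)^2]. *)
have /choice[u uP] : forall n, exists x, J x < m + (2 ^- n) ^+ 2.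
  move=> n; have e0 : 0 < (2 ^- n : R) ^+ 2 by rewrite exprn_gt0// exp2V_gt0.
  by have [_ [x _ <-] Jx] := inf_adherent e0 hJ; exists x.
have [|l _ ul] := @fast_cauchy_cvg R H u 2.
  move=> i j ij.
  have eij : 2 ^- j <= 2 ^- i :> R by exact: ler_exp2V.
  rewrite -(@ler_pXn2r _ 2)// ?nnegrE ?mulr_ge0 ?exp2V_ge0//.
  have := mJ (2^-1 *: (u i + 1 *: u j)); have := uP i; have := uP j.
  have e0 := exp2V_ge0 R j; have e1 := exp2V_ge0 R i.
  rewrite /J fZ !fDZ normrZ ger0_norm ?invr_ge0// exprMn dot_sqrDZ dot_sqrB.
  have : (2 ^- j : R) ^+ 2 <= (2 ^- i) ^+ 2 by rewrite ler_pXn2r.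
  by set p := '[_, _]; lra.
exists l => x; rewrite dotC.
(* Moving from [u n] by [2 ^- n] along [x] or [- x] lowers [J] by less than [(2 ^- n)^2], which
   bounds its directional derivative, twice the difference estimated here. *)
have ux n : `|'[u n, x] - f x| <= 2 ^- n * (1 + `|x| ^+ 2).
  have e0 := exp2V_gt0 R n; have := uP n.
  have := mJ (u n + 2 ^- n *: x); have := mJ (u n + (- 2 ^- n) *: x).
  rewrite /J !dot_sqrDZ !fDZ sqrrN; set e : R := 2 ^- n in e0 *.
  set d := '[_, _]; move=> h1 h2 h3.
  rewrite ler_norml; apply/andP; split.
    by rewrite -(ler_pM2l e0); have := sqr_ge0 `|x|; nra.
  by rewrite -(ler_pM2l e0); have := sqr_ge0 `|x|; nra.
apply/eqP; rewrite eq_sym -subr_eq0 -normr_le0.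
apply: (@le_eps_exp2 _ _ _ (2 * `|x| + (1 + `|x| ^+ 2))) => [|n].
  by rewrite addr_ge0 ?mulr_ge0// addr_ge0// exprn_ge0.
rewrite add0r -['[l, x]](subrK '[u n, x]) -addrA.
apply: le_trans (ler_normD _ _) _; rewrite mulrDl lerD//; last by rewrite mulrC.
rewrite -dotBl; apply: le_trans (cauchy_schwarz _ _) _.
by rewrite distrC mulrAC ler_wpM2r.
Qed.

Lemma functional_norm_dot (f : H -> R) y : (forall x, f x = '[x, y]) ->
  `|y| = functional_norm f.
Proof.
move=> fy; apply/eqP; rewrite eq_le; apply/andP; split.
  apply: sup_ubound.
    exists `|y| => _ [x /= x1 <-]; rewrite fy.
    by apply: le_trans (cauchy_schwarz _ _) _; rewrite ler_piMl.
  have [->|y0] := eqVneq y 0.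
    by exists 0; rewrite /= ?normr0// fy dot0l normr0.
  have ny : `|y| != 0 by rewrite normr_eq0.
  exists (`|y|^-1 *: y).
    by rewrite /= normrZ ger0_norm ?invr_ge0// mulVf.
  by rewrite fy dotZl dotxx expr2 mulKf// normr_id.
apply: ge_sup.
  by exists `|f 0|, 0; rewrite /= ?normr0.
move=> _ [x /= x1 <-]; rewrite fy.
by apply: le_trans (cauchy_schwarz _ _) _; rewrite ler_piMl.
Qed.

Lemma bounded_linear_dot y : bounded_linear (fun x => '[x, y]).
Proof.
split=> [t x z|]; first by rewrite dotDl dotZl.
exists `|y| => _ [x /= x1 <-].
by apply: le_trans (cauchy_schwarz _ _) _; rewrite ler_piMl.
Qed.

(** A Gram-Schmidt step: [d] is the part of [v n] orthogonal to the earlier vectors, and the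
    remainder [r] of [x] is corrected along [d]. Linear independence is not assumed: if [d = 0],
    then [t = 0] by the convention on division, and no correction is made. *)
Lemma orthogonal_projection (v : nat -> H) n x : exists c : nat -> R,
  forall i, (i < n)%N -> '[x - \sum_(j < n) c j *: v j, v i] = 0.
Proof.
elim: n x => [|n IH] x; first by exists (fun=> 0).
have [c cP] := IH (v n); have [b bP] := IH x.
set d := v n - _ in cP; set r := x - _ in bP.
have dS : v n = d + \sum_(j < n) c j *: v j by rewrite /d subrK.
have orth s z : (forall i, (i < n)%N -> '[z, v i] = 0) ->
    '[z, \sum_(j < n) s j *: v j] = 0.
  move=> zv; rewrite dot_sumr big1// => j _.
  by rewrite dotZr zv// mulr0.
pose t := '[r, d] / `|d| ^+ 2.
exists (fun j => if (j < n)%N then b j - t * c j else t) => i.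
have -> : x - \sum_(j < n.+1) (if (j < n)%N then b j - t * c j else t) *: v j =
    r - t *: d.
  rewrite big_ord_recr /= ltnn /r /d.
  rewrite (eq_bigr (fun j : 'I_n => b j *: v j - t *: (c j *: v j))); last first.
    by move=> j _; rewrite ltn_ord scalerBl scalerA.
  rewrite sumrB -scaler_sumr scalerBr !opprD !opprK -!addrA.
  by congr (_ + (_ + _)); exact: addrC.
rewrite ltnS leq_eqVlt => /predU1P[->|ni].
  rewrite dS dotDr orth ?addr0; last first.
    by move=> k kn; rewrite dotBl dotZl bP// cP// mulr0 subr0.
  rewrite dotBl dotZl dotxx /t.
  have [->|d0] := eqVneq d 0; first by rewrite dot0r normr0; ring.
  by rewrite divfK ?subrr// expf_neq0// normr_eq0.
by rewrite dotBl dotZl bP// cP// mulr0 subr0.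
Qed.

(** A nonzero projection remainder can be normalised; if all remainders vanished, the first [n]
    vectors would span [H]. *)
Lemma unit_orthogonal (v : nat -> H) n : ~ finite_dimensional H ->
  exists2 u : H, `|u| = 1 & forall i, (i < n)%N -> '[u, v i] = 0.
Proof.
move=> ninf; apply: contrapT => nu; apply: ninf.
exists n, (fun i => v i) => x; have [c cP] := orthogonal_projection v n x.
exists (fun i => c i); apply/eqP; rewrite -subr_eq0; apply/negP => /negP r0.
apply: nu; set r := x - _ in r0 cP.
exists (`|r|^-1 *: r); first by rewrite normrZ ger0_norm ?invr_ge0// mulVf// normr_eq0.
by move=> i ni; rewrite dotZl cP// mulr0.
Qed.

End InnerProduct.

(** * Reduction of FRR to MCT *)

(** The realizer of the inner product is run on constant names of [a i] and [a k], interleaved into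
    one oracle. These depend on the indices only, so [B] is computable on every [D]. *)
Lemma dot_approximation (R : realType) (H : computable_hilbert R) :
  exists B : nat -> nat -> nat -> nat,
    (forall i k l,
      `|rat_enum R (B i k l) - hdot H (hseq H i) (hseq H k)| <= 2 ^- l) /\
    (forall D, computable_on D
      (fun _ z => B (nfst z) (nfst (nsnd z)) (nsnd (nsnd z)))).
Proof.
have [c cP] := hdot_computable H.
pose r (z : nat) : baire := fun m => if odd m then nsnd z else nfst z.
have cst_name i : name (hrep H) (fun=> i) (hseq H i).
  by apply: cauchy_nameI => j; rewrite subrr normr0 exp2V_ge0.
have /choice[B BP] : forall z, exists b, computes c (r z) b /\
    name (real_rep R) b (hdot H (hseq H (nfst z)) (hseq H (nsnd z))).
  move=> z; have [||b [y [cb bn yE]]] := cP (r z) (hseq H (nfst z), hseq H (nsnd z)).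
  - have e0 : even_part (r z) = fun=> nfst z.
      by apply/funext => m; rewrite /even_part /r odd_double.
    have e1 : odd_part (r z) = fun=> nsnd z.
      by apply/funext => m; rewrite /odd_part /r /= odd_double.
    by split; rewrite ?e0 ?e1; exact: cst_name.
  - by eexists; reflexivity.
  - by exists b; split=> //; rewrite yE in bn.
exists (fun i k => B (npair i k)); split=> [i k l|D].
  have [_ /(@real_name_dist _ _ _ l)] := BP (npair i k).
  by rewrite npairK1 npairK2.
have h : computable_on D (fun _ z => B (nfst z) (nsnd z)).
  apply: (@computable_relative D c (fun _ => r) (fun _ => B)).
    by move=> _ i _; have [] := BP i.
  by rewrite /r; eauto 100 with comp.
apply: (@computable_app2 D (fun _ => B)) => //; eauto 100 with comp.
Qed.

(** Written as an iteration, so that its computability is immediate. *)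
Definition const_code (i k : nat) : nat := iteri k (fun _ s => (npair i s).+1) 0%N.

Lemma const_codeE i k : const_code i k = seq_code (mkseq (fun=> i) k).
Proof.
rewrite /mkseq; elim: k 0%N => //= k IH m.
by rewrite -(IH m.+1) /const_code.
Qed.

(** The constant sequence [i] names the [i]-th point of the dense sequence. *)
Definition associate_eval (P : baire) (i t : nat) : nat :=
  (P (npair t (const_code i
     (mu (fun k => (0 < P (npair t (const_code i k)))%N))))).-1.

Section AssociateEval.
Variables (R : realType) (H : computable_hilbert R).

(** The second conjunct is the termination condition for the search inside [associate_eval]. *)
Lemma associate_evalP P (f : continuous_real_rep H) i t :
  name (continuous_real_rep H) P f ->
  `|rat_enum R (associate_eval P i t) - f (hseq H i)| <= 2 ^- t /\
  exists k, (0 < P (npair t (const_code i k)))%N.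
Proof.
move=> Pf.
have [|r [Pr rf]] := Pf (fun=> i) (hseq H i).
  by apply: cauchy_nameI => j; rewrite subrr normr0 exp2V_ge0.
have [k [Pk Pmin]] := Pr t.
have ek : exists k, (0 < P (npair t (const_code i k)))%N.
  by exists k; rewrite const_codeE Pk.
split=> //; rewrite /associate_eval.
rewrite (_ : mu _ = k); first by rewrite const_codeE Pk; exact: (cauchy_name_dist t rf).
apply/eqP; rewrite eqn_leq mu_min ?const_codeE ?Pk//= leqNgt; apply/negP => /Pmin.
by rewrite -const_codeE => e; have := mu_ex ek; rewrite e.
Qed.

Lemma computable_associate_eval D (P : baire -> baire) F G :
  (forall p, D p -> exists f, name (continuous_real_rep H) (P p) f) ->
  computable_on D (fun p n => P p n) -> computable_on D F -> computable_on D G ->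
  computable_on D (fun p n => associate_eval (P p) (F p n) (G p n)).
Proof.
move=> PD cP; apply: (@computable_app2 D (fun p i t => associate_eval (P p) i t)).
have cc F' G' : computable_on D F' -> computable_on D G' ->
    computable_on D (fun p n => const_code (F' p n) (G' p n)).
  apply: (@computable_app2 D (fun _ => const_code)).
  apply: (@computable_iteri D (fun _ z _ s => (npair (nfst z) s).+1));
    by eauto 100 with comp.
have cm : computable_on D (fun p z =>
    mu (fun k => (0 < P p (npair (nsnd z) (const_code (nfst z) k)))%N)).
  apply: computable_mu.
    move=> p n Dp; have [f Pf] := PD p Dp.
    by have [_] := associate_evalP (nfst n) (nsnd n) Pf.
  apply: computable_leq; first by eauto with comp.
  by apply: (computable_app cP); eauto 100 with comp.
rewrite /associate_eval; apply: computable_pred; apply: (computable_app cP).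
by eauto 100 with comp.
Qed.

End AssociateEval.

Section FrechetRieszReducesToMCT.
Variables (R : realType) (H : computable_hilbert R).
Variable B : nat -> nat -> nat -> nat.
Hypothesis B_dist : forall i k l,
  `|rat_enum R (B i k l) - hdot H (hseq H i) (hseq H k)| <= 2 ^- l.
Hypothesis B_computable : forall D,
  computable_on D (fun _ z => B (nfst z) (nfst (nsnd z)) (nsnd (nsnd z))).
Local Notation a := (hseq H).
Local Notation q := (rat_enum R).
Local Notation X := (continuous_real_rep H).

(** An approximation of [2 f (a i) - |a i|^2 = |y|^2 - |a i - y|^2]. *)
Definition gain (P : baire) (i t : nat) : nat :=
  rat_add (rat_add (associate_eval P i (t + 3)) (associate_eval P i (t + 3)))
    (rat_opp (B i i (t + 3))).

Lemma gainP P (f : X) y i t : name X P f -> FRR f y ->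
  `|q (gain P i t) - (`|y| ^+ 2 - `|a i - y| ^+ 2)| <= 2 ^- t.
Proof.
move=> Pf [_ fy]; rewrite /gain !rat_addE rat_oppE dot_sqrB -fy.
have [h _] := associate_evalP i (t + 3) Pf; have h' := B_dist i i (t + 3).
rewrite dotxx in h'.
have e : 2 ^- t = 8 * 2 ^- (t + 3) :> R.
  by rewrite addn3 (exp2VS R t) (exp2VS R t.+1) (exp2VS R t.+2); ring.
rewrite e; move: h h'; rewrite !ler_norml => /andP[h1 h2] /andP[h3 h4].
by apply/andP; split; lra.
Qed.

Lemma computable_gain D (P : baire -> baire) F G :
  (forall p, D p -> exists f, name X (P p) f) ->
  computable_on D (fun p n => P p n) -> computable_on D F -> computable_on D G ->
  computable_on D (fun p n => gain (P p) (F p n) (G p n)).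
Proof.
move=> PD cP cF cG; rewrite /gain.
have c3 : computable_on D (fun p n => (G p n + 3)%N) by eauto with comp.
have cf : computable_on D (fun p n => associate_eval (P p) (F p n) (G p n + 3)).
  exact: (computable_associate_eval PD).
have cB : computable_on D (fun p n => B (F p n) (F p n) (G p n + 3)).
  exact: (@computable_app3 D (fun _ => B)).
by eauto with comp.
Qed.

(** The index [m] codes a point and a precision [t]; subtracting [2 ^- t] turns the approximation
    into a lower bound of [|y|^2 - |a i - y|^2], hence of [|y|^2]. *)
Definition gain_lower (P : baire) (m : nat) : nat :=
  rat_add (gain P (nfst m) (nsnd m)) (rat_opp (rat_scale (nsnd m) (rat_nat 1))).

(** The running maximum makes the lower bounds an increasing sequence, as [MCT] demands. *)
Definition gain_max (P : baire) (n : nat) : nat :=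
  iteri n (fun k s =>
    if rat_le s (gain_lower P k.+1) then gain_lower P k.+1 else s) (gain_lower P 0).

Lemma computable_gain_max D (P : baire -> baire) F :
  (forall p, D p -> exists f, name X (P p) f) ->
  computable_on D (fun p n => P p n) -> computable_on D F ->
  computable_on D (fun p n => gain_max (P p) (F p n)).
Proof.
move=> PD cP cF.
have cl G : computable_on D G -> computable_on D (fun p n => gain_lower (P p) (G p n)).
  move=> cG; rewrite /gain_lower.
  have cg : computable_on D (fun p n => gain (P p) (nfst (G p n)) (nsnd (G p n))).
    by apply: (computable_gain PD cP); eauto with comp.
  by eauto 20 with comp.
apply: (@computable_iteri D (fun p _ k s =>
  if rat_le s (gain_lower (P p) k.+1) then gain_lower (P p) k.+1 else s)) => //.
  exact: cl (computable_const D 0).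
have c1 : computable_on D (fun p z => gain_lower (P p) (nfst (nsnd z)).+1).
  by apply: cl; eauto with comp.
by eauto 20 with comp.
Qed.

Lemma gain_max_nondecreasing P : nondecreasing_seq (fun n => q (gain_max P n)).
Proof.
apply/nondecreasing_seqP => n; rewrite /gain_max /= -/(gain_max P n).
by case: ifP => //; rewrite (rat_leE R).
Qed.

Lemma gain_lower_le_max P m n : (m <= n)%N ->
  q (gain_lower P m) <= q (gain_max P n).
Proof.
move=> mn; apply: le_trans (gain_max_nondecreasing P mn).
case: m {mn} => [//|m]; rewrite /gain_max /= -/(gain_max P m).
by case: ifPn => //; rewrite (rat_leE R) -ltNge => /ltW.
Qed.

Lemma gain_max_in P n : exists m, gain_max P n = gain_lower P m.
Proof.
elim: n => [|n [m IH]]; first by exists 0%N.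
rewrite /gain_max /= -/(gain_max P n).
by case: ifP => _; [exists n.+1|exists m].
Qed.

Lemma gain_max_le P (f : X) y n : name X P f -> FRR f y ->
  q (gain_max P n) <= `|y| ^+ 2.
Proof.
move=> Pf fy; have [m ->] := gain_max_in P n.
rewrite /gain_lower rat_addE rat_oppE rat_scaleE rat_natE.
have := gainP (nfst m) (nsnd m) Pf fy; rewrite ler_norml => /andP[_].
have := sqr_ge0 `|a (nfst m) - y|; lra.
Qed.

Lemma gain_max_sup P (f : X) y : name X P f -> FRR f y ->
  sup (range (fun n => q (gain_max P n))) = `|y| ^+ 2.
Proof.
move=> Pf fy; have ub : has_ubound (range (fun n => q (gain_max P n))).
  by exists (`|y| ^+ 2) => _ [n _ <-]; exact: gain_max_le fy.
apply/eqP; rewrite eq_le; apply/andP; split.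
  apply: ge_sup; first by exists (q (gain_max P 0)), 0%N.
  by move=> _ [n _ <-]; exact: gain_max_le fy.
(* One [2 ^- t] each is lost to [|a i - y|^2], to the approximation error and to the shift in
   [gain_lower]. *)
apply: (@le_eps_exp2 _ _ _ 3) => // t.
have [i iy] := dense_dist (@hseq_dense R H) y (exp2V_gt0 R t).
have : q (gain_lower P (npair i t)) <= sup (range (fun n => q (gain_max P n))).
  apply: le_trans (gain_lower_le_max P (leqnn _)) _.
  by apply: ub_le_sup => //; exists (npair i t).
rewrite /gain_lower npairK1 npairK2 rat_addE rat_oppE rat_scaleE rat_natE.
have := gainP i t Pf fy; rewrite ler_norml => /andP[+ _].
have : `|a i - y| ^+ 2 <= 2 ^- t.
  apply: le_trans (ltW iy); rewrite expr2 ler_piMl//.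
  exact: le_trans (ltW iy) (exp2V_le1 _ _).
have := exp2V_ge0 R t; lra.
Qed.

(** Put [t = 2 n + 5]. With errors of [2 ^- t] on both sides, the test succeeds when
    [|a i - y|^2 <= 2 ^- t], and success gives [|a i - y|^2 <= 5 * 2 ^- t], which is below
    [8 * 2 ^- t = (2 ^- n.+1)^2]. *)
Definition riesz_search (r : baire) (n : nat) : nat :=
  mu (fun i => rat_le (rat_add (odd_part r (2 * n + 5))
      (rat_opp (gain (even_part r) i (2 * n + 5))))
    (rat_scale (2 * n + 5) (rat_nat 3))).

Lemma riesz_searchP r (f : X) y n : name (prod_rep X (real_rep R)) r (f, `|y| ^+ 2) ->
  FRR f y ->
  `|a (riesz_search r n) - y| <= 2 ^- n.+1 /\
  exists i, rat_le (rat_add (odd_part r (2 * n + 5))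
      (rat_opp (gain (even_part r) i (2 * n + 5))))
    (rat_scale (2 * n + 5) (rat_nat 3)).
Proof.
move=> [/= rf /real_name_dist rs] fy; set t := (2 * n + 5)%N.
have {}rs := rs t.
set P := fun i : nat => _.
have ex : exists i, P i.
  have [i iy] := dense_dist (@hseq_dense R H) y (exp2V_gt0 R t).
  exists i; rewrite /P (rat_leE R) rat_addE rat_oppE rat_scaleE rat_natE.
  move: rs; rewrite ler_norml => /andP[_].
  have := gainP i t rf fy; rewrite ler_norml => /andP[+ _].
  have : `|a i - y| ^+ 2 <= 2 ^- t.
    apply: le_trans (ltW iy); rewrite expr2 ler_piMl//.
    exact: le_trans (ltW iy) (exp2V_le1 _ _).
  lra.
split=> //; have := mu_ex ex; rewrite -/(riesz_search r n).
set i := riesz_search r n.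
rewrite /P (rat_leE R) rat_addE rat_oppE rat_scaleE rat_natE => h.
rewrite -(@ler_pXn2r _ 2)// ?nnegrE ?exp2V_ge0//.
have -> : (2 ^- n.+1) ^+ 2 = 8 * 2 ^- t :> R.
  rewrite exprVn -exprM (_ : t = n.+1 * 2 + 3)%N.
    have e8 : 8 * 2 ^- 3 = 1 :> R by field.
    by move: (n.+1 * 2)%N => N; rewrite exprD invfM mulrCA e8 mulr1.
  by rewrite /t -addn1; ring.
move: rs h; rewrite ler_norml => /andP[rs _].
have := gainP i t rf fy; rewrite ler_norml => /andP[_].
have := exp2V_ge0 R t; lra.
Qed.

Lemma FRR_le_MCT : weihrauch_le (@FRR R H) (@MCT R).
Proof.
exists (fun fs y => FRR fs.1 y /\ fs.2 = `|y| ^+ 2).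
(* The preprocessing is multi-valued, since the sequence depends on the name of [f]; only its
   supremum is determined. *)
exists (fun f x => exists y, [/\ FRR f y, nondecreasing_seq x,
  has_ubound (range x) & sup (range x) = `|y| ^+ 2]).
have KP P (f : X) y : name X P f -> FRR f y ->
    exists y', [/\ FRR f y', nondecreasing_seq (fun n => q (gain_max P n)),
      has_ubound (range (fun n => q (gain_max P n))) &
      sup (range (fun n => q (gain_max P n))) = `|y'| ^+ 2].
  move=> Pf fy; exists y; split=> //.
  - exact: gain_max_nondecreasing.
  - by exists (`|y| ^+ 2) => _ [n _ <-]; exact: gain_max_le fy.
  - exact: gain_max_sup fy.
split.
- pose D := [set r | exists f y,
    name (prod_rep X (real_rep R)) r (f, `|y| ^+ 2) /\ FRR f y].
  have [|c cP] := @computable_onP D riesz_search.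
    apply: computable_mu => [r n [f [y [rf fy]]]|].
      by have [] := riesz_searchP n rf fy.
    have PD r : D r -> exists f, name X (even_part r) f.
      by move=> [f [y [[rf _] _]]]; exists f.
    have cP : computable_on D (fun r n => even_part r n).
      by rewrite /even_part; eauto with comp.
    have cg : computable_on D (fun r z =>
        gain (even_part r) (nsnd z) (2 * nfst z + 5)).
      by apply: (computable_gain PD cP); eauto with comp.
    by rewrite /odd_part; eauto 20 with comp.
  exists c => r [f s] rfs [y [/= fy sy]]; rewrite sy in rfs.
  exists (riesz_search r), y; split=> //; first by apply: cP; exists f, y.
  by apply: cauchy_nameI => n; have [] := riesz_searchP n rfs fy.
- pose D := [set p | exists f, name X p f].
  (* The terms are rational, so each is named by a constant sequence and the second component of [z]
     is ignored. *)
  have [|c cP] := @computable_onP D (fun p z => gain_max p (nfst z)).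
    apply: (@computable_gain_max D (fun p => p)) => //; eauto with comp.
  exists c => p f pf [x [y [fy _ _ _]]].
  exists (fun z => gain_max p (nfst z)), (fun n => q (gain_max p n)).
  split; [by apply: cP; exists f| |exact: KP fy].
  move=> n; have -> : (fun m => gain_max p (nfst (npair n m))) = fun=> gain_max p n.
    by apply/funext => m; rewrite npairK1.
  exact: real_name_cst.
- move=> f [y fy]; split.
    have [P Pf] := name_surj f.
    by exists (fun n => q (gain_max P n)); exact: KP fy.
  move=> x [y' [fy' ndx ubx xy']]; split; first by exists (sup (range x)).
  move=> s [_ _ ->]; split; first by exists y'.
  by move=> z [].
Qed.

End FrechetRieszReducesToMCT.

(** * Encoding a semi-decidable set as a vector *)

Section AlmostOrthonormal.
Variables (R : realType) (H : computable_hilbert R).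
Variable B : nat -> nat -> nat -> nat.
Hypothesis B_dist : forall i k l,
  `|rat_enum R (B i k l) - hdot H (hseq H i) (hseq H k)| <= 2 ^- l.
Hypothesis B_computable : forall D,
  computable_on D (fun _ z => B (nfst z) (nfst (nsnd z)) (nsnd (nsnd z))).
Hypothesis infinite_dim : ~ finite_dimensional H.
Local Notation a := (hseq H).
Local Notation q := (rat_enum R).
Local Notation "''[' x , y ]" := (hdot H x y) : ring_scope.

Lemma computable_B D F G L : computable_on D F -> computable_on D G ->
  computable_on D L -> computable_on D (fun p n => B (F p n) (G p n) (L p n)).
Proof. exact: (@computable_app3 D (fun _ => B)). Qed.

(** The estimate errs by at most [2 ^- b.+2], so the test accepts inner products up to [2 ^- b.+2]
    and excludes those above [2 ^- b]. *)
Definition almost_orthogonal (b s i : nat) : bool :=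
  rat_le (B s i (b + 2)) (rat_scale b.+1 (rat_nat 1)) &&
  rat_le (rat_opp (B s i (b + 2))) (rat_scale b.+1 (rat_nat 1)).

Definition almost_unit (s : nat) : bool :=
  rat_le (B s s 3) (rat_scale 2 (rat_nat 5)) &&
  rat_le (rat_scale 2 (rat_nat 3)) (B s s 3).

(** The comparison with [first_below] is a bounded universal quantifier: no [i < b] fails the
    orthogonality test. *)
Definition fresh (b s : nat) : bool :=
  (b <= first_below (fun i => ~~ almost_orthogonal b s i) b)%N && almost_unit s.

Lemma fresh_dot b s i : fresh b s -> (i < b)%N -> `|'[a i, a s]| <= 2 ^- b.
Proof.
move=> /andP[h _] /(first_below_all h); rewrite negbK dotC.
rewrite /almost_orthogonal !(rat_leE R) rat_oppE !rat_scaleE rat_natE mulr1.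
have := B_dist s i (b + 2); rewrite addn2 (exp2VS R b) (exp2VS R b.+1).
rewrite !ler_norml => /andP[h1 h2] /andP[h3 h4].
have := exp2V_ge0 R b.+2.
by move=> h5; apply/andP; split; lra.
Qed.

Lemma fresh_norm b s : fresh b s -> 2^-1 <= `|a s| ^+ 2 /\ `|a s| <= 2.
Proof.
move=> /andP[_]; rewrite /almost_unit !(rat_leE R) !rat_scaleE !rat_natE.
have := B_dist s s 3; rewrite dotxx ler_norml => /andP[h1 h2] /andP[h3 h4].
have e2 : 2 ^- 2 = 4^-1 :> R by field.
have e3 : 2 ^- 3 = 8^-1 :> R by field.
rewrite e2 e3 in h1 h2 h3 h4; split; first by lra.
by have := normr_ge0 (a s); nra.
Qed.

(** A dense point close enough to a unit vector orthogonal to the first [b] points passes both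
    tests. *)
Lemma fresh_ex b : exists s, fresh b s.
Proof.
have [u u1 uo] := unit_orthogonal a b infinite_dim.
pose C := \sum_(i < b) `|a i|.
have C0 : 0 <= C by exact: sumr_ge0.
have C1 : 0 < C + 1 by rewrite ltr_wpDl.
(* Dividing by [C + 1] compensates the norms of the [a i], which multiply the distance in the
   Cauchy-Schwarz bound; the [5] leaves room for the norm test. *)
have d0 : 0 < 2 ^- (b + 5) / (C + 1) :> R by rewrite divr_gt0// exp2V_gt0.
have [s] := dense_dist (@hseq_dense R H) u d0.
rewrite ltr_pdivlMr//; set d := `|a s - u| => dC.
have dge0 : 0 <= d by exact: normr_ge0.
have d5 : d <= 2 ^- 5.
  have := ler_exp2V R (leq_addl b 5); have : d <= d * (C + 1) by nra.
  lra.
exists s; apply/andP; split.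
  rewrite leqNgt; apply/negP => lt.
  have [_ /(_ lt)] := first_below_spec (fun i => ~~ almost_orthogonal b s i) b.
  move=> + _; set i := first_below _ _ in lt *; apply/negP; rewrite negbK.
  rewrite /almost_orthogonal !(rat_leE R) rat_oppE !rat_scaleE rat_natE mulr1.
  have : `|'[a s, a i]| <= 2 ^- b.+2.
    rewrite -['[_, _]]subr0 -(uo i lt) -dotBl.
    apply: le_trans (cauchy_schwarz _ _) _.
    have := ler_exp2V R (leq_addr 3 b.+2); rewrite -/d.
    have : `|a i| <= C.
      by rewrite /C (bigD1 (Ordinal lt))//= lerDl sumr_ge0.
    move: dC; rewrite [in X in X -> _](_ : (b + 5)%N = (b.+2 + 3)%N).
      by have := normr_ge0 (a i); nra.
    by lia.
  have := B_dist s i (b + 2); rewrite addn2 (exp2VS R b.+1).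
  rewrite !ler_norml => /andP[h1 h2] /andP[h3 h4].
  by apply/andP; split; lra.
rewrite /almost_unit !(rat_leE R) !rat_scaleE !rat_natE.
have e2 : 2 ^- 2 = 4^-1 :> R by field.
have e3 : 2 ^- 3 = 8^-1 :> R by field.
have e5 : 2 ^- 5 = 32^-1 :> R by field.
have := B_dist s s 3; rewrite dotxx e2 e3.
have : `| `|a s| - 1| <= d by rewrite -u1; exact: ler_dist_dist.
rewrite !ler_norml => /andP[h1 h2] /andP[h3 h4].
have := normr_ge0 (a s); rewrite e5 in d5 => h5.
by apply/andP; split; nra.
Qed.

Definition fresh_index (b : nat) : nat := mu (fresh b).

(** The next stage exceeds the index just chosen, so later vectors are almost orthogonal to the
    vectors already chosen, not only to a growing initial segment of [a]. *)
Definition stage (k : nat) : nat := iteri k (fun _ b => (b + fresh_index b).+1) 0%N.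

Definition sigma (k : nat) : nat := fresh_index (stage k).

Lemma sigma_fresh k : fresh (stage k) (sigma k).
Proof. exact/mu_ex/fresh_ex. Qed.

Lemma stage_leq k l : (k <= l)%N -> (stage k <= stage l)%N.
Proof.
elim: l => [|l IH]; first by rewrite leqn0 => /eqP ->.
rewrite leq_eqVlt => /predU1P[-> //|]; rewrite ltnS => /IH kl.
by apply: leq_trans kl _; rewrite /stage /= -/(stage l) leqW// leq_addr.
Qed.

Lemma sigma_stage k l : (k < l)%N -> (sigma k < stage l)%N.
Proof.
move=> /stage_leq; apply: leq_trans.
by rewrite [stage k.+1]/stage /= -/(stage k) ltnS leq_addl.
Qed.

Lemma leq_stage k : (k <= stage k)%N.
Proof.
elim: k => // k IH; rewrite /stage /= -/(stage k) ltnS.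
exact: leq_trans IH (leq_addr _ _).
Qed.

Definition almost_basis (k : nat) : H := a (sigma k).
Local Notation e := almost_basis.

Lemma almost_basis_norm k : 2^-1 <= `|e k| ^+ 2 /\ `|e k| <= 2.
Proof. exact: fresh_norm (sigma_fresh k). Qed.

Lemma almost_basis_dense i k : (i < k)%N -> `|'[a i, e k]| <= 2 ^- k.
Proof.
move=> ik; apply: le_trans (ler_exp2V R (leq_stage k)).
apply: fresh_dot (sigma_fresh k) _; exact: leq_trans ik (leq_stage k).
Qed.

(** The vector chosen later is the one tested against the other, so the larger index governs the
    bound. *)
Lemma almost_basis_dot k l : k != l -> `|'[e k, e l]| <= 2 ^- k.
Proof.
have main i j : (i < j)%N -> `|'[e i, e j]| <= 2 ^- j.
  move=> ij; apply: le_trans (ler_exp2V R (leq_stage j)).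
  by apply: fresh_dot (sigma_fresh j) _; exact: sigma_stage.
case: (ltngtP k l) => // kl _; last by rewrite dotC main.
by apply: le_trans (main _ _ kl) _; rewrite ler_exp2V// ltnW.
Qed.

Lemma computable_sigma D F : computable_on D F ->
  computable_on D (fun p n => sigma (F p n)).
Proof.
have cf G : computable_on D G -> computable_on D (fun p n => fresh_index (G p n)).
  apply: (@computable_app D (fun _ => fresh_index)).
  apply: computable_mu => [_ b _|]; first exact: fresh_ex.
  apply: computable_andb.
    apply: computable_leq; first by eauto with comp.
    apply: (@computable_first_below D (fun _ z i =>
      ~~ almost_orthogonal (nfst z) (nsnd z) i)); last by eauto with comp.
    apply: computable_negb; rewrite /almost_orthogonal.
    have cB : computable_on D (fun _ z =>
        B (nsnd (nfst z)) (nsnd z) (nfst (nfst z) + 2)).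
      by apply: computable_B; eauto with comp.
    by eauto 20 with comp.
  rewrite /almost_unit.
  have cB : computable_on D (fun _ z => B (nsnd z) (nsnd z) 3).
    by apply: computable_B; eauto with comp.
  by eauto 20 with comp.
move=> cF; apply: (cf).
apply: (@computable_iteri D (fun _ _ _ b => (b + fresh_index b).+1)) => //.
  exact: computable_const.
have c1 : computable_on D (fun _ z => fresh_index (nsnd (nsnd z))).
  by apply: cf; eauto with comp.
by eauto with comp.
Qed.

(** * The encoding vector: its inner products and its decoding *)

Section EncodedSet.
Variable T : nat -> pred nat.

(** The set of the [j] with [T j m] for some [m] is encoded by the vector
    [\sum_j 2 ^- j *: e (mu (T j))], where [j] ranges over that set. *)
Definition encoding_term (j : nat) : H :=
  if pselect (exists m, T j m) then 2 ^- j *: e (mu (T j)) else 0.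

Definition encoding_sum (n : nat) : H := \sum_(j < n) encoding_term j.

Definition encoding : H := lim (encoding_sum @ \oo).

Lemma encoding_term_norm j : `|encoding_term j| <= 2 * 2 ^- j.
Proof.
rewrite /encoding_term; case: pselect => h.
  rewrite normrZ ger0_norm ?exp2V_ge0// mulrC ler_wpM2r ?exp2V_ge0//.
  by have [] := almost_basis_norm (mu (T j)).
by rewrite normr0 mulr_ge0// exp2V_ge0.
Qed.

Lemma encoding_cvg : encoding_sum @ \oo --> encoding /\
  forall n, `|encoding_sum n - encoding| <= 4 * 2 ^- n.
Proof.
have [|l cl dl] := @fast_cauchy_cvg R H encoding_sum 4.
  (* The sharper bound telescopes, so it goes through by induction on [j]. *)
  move=> i j ij; suff : `|encoding_sum i - encoding_sum j| <= 4 * (2 ^- i - 2 ^- j).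
    by have := exp2V_ge0 R j; lra.
  elim: j ij => [|j IH]; first by rewrite leqn0 => /eqP ->; rewrite !subrr normr0 mulr0.
  rewrite leq_eqVlt => /predU1P[->|/IH {}IH]; first by rewrite !subrr normr0 mulr0.
  rewrite [encoding_sum j.+1]/encoding_sum big_ord_recr /= -/(encoding_sum j) opprD addrA.
  apply: le_trans (ler_normB _ _) _.
  by have := encoding_term_norm j; rewrite (exp2VS R j) in IH *; lra.
by rewrite /encoding (cvg_lim _ cl).
Qed.

Lemma encoding_norm : `|encoding| <= 4.
Proof.
have := encoding_cvg.2 0%N.
by rewrite /encoding_sum big_ord0 sub0r normrN expr0 invr1 mulr1.
Qed.

(** [first_below (T j) Q] finds the least witness if it is below [Q]; a witness
    [m >= Q > i] contributes little, since [e m] is almost orthogonal to [a i]. *)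
Definition approx_term (i Q j : nat) : nat :=
  if (first_below (T j) Q < Q)%N
  then rat_scale j (B i (sigma (first_below (T j) Q)) Q) else rat_nat 0.

Definition approx_sum (i Q : nat) : nat :=
  iteri Q (fun j s => rat_add s (approx_term i Q j)) (rat_nat 0).

(** The cutoff exceeds [i], as [approx_termP] requires. Its last summand bounds [|a i|], because
    [|a i|^2 <= rat_pos (B i i 0) + 1], and so absorbs that factor in the tail error; [n + 5]
    provides the accuracy. *)
Definition approx_dot (i n : nat) : nat :=
  approx_sum i (n + 5 + i + (rat_pos (B i i 0)).+2).

Lemma approx_termP i Q j : (i < Q)%N ->
  `|q (approx_term i Q j) - '[a i, encoding_term j]| <= 2 ^- Q * 2 ^- j.
Proof.
move=> iQ; rewrite /approx_term /encoding_term.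
have p0 : 0 <= 2 ^- Q * 2 ^- j :> R by rewrite mulr_ge0 ?exp2V_ge0.
have [lt|ge] := ltnP.
  have [_ /(_ lt) Tf _] := first_below_spec (T j) Q.
  case: pselect => [h|[]]; last by eexists; exact: Tf.
  rewrite first_below_mu// rat_scaleE dotZr -mulrBr normrM ger0_norm ?exp2V_ge0//.
  by rewrite mulrC ler_wpM2r ?exp2V_ge0.
rewrite rat_natE; case: pselect => [ex|h]; last by rewrite dot0r subrr normr0.
rewrite dotZr sub0r normrN normrM ger0_norm ?exp2V_ge0// mulrC.
rewrite ler_wpM2r ?exp2V_ge0//.
have Qm : (Q <= mu (T j))%N.
  by rewrite leqNgt; apply/negP => /(first_below_all ge); rewrite mu_ex.
by apply: le_trans (almost_basis_dense (leq_trans iQ Qm)) (ler_exp2V R Qm).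
Qed.

Lemma approx_sumP i Q : (i < Q)%N ->
  `|q (approx_sum i Q) - '[a i, encoding_sum Q]| <= 2 * 2 ^- Q.
Proof.
move=> iQ; rewrite /approx_sum /encoding_sum.
have -> n : q (iteri n (fun j s => rat_add s (approx_term i Q j)) (rat_nat 0)) =
    \sum_(j < n) q (approx_term i Q j).
  elim: n => [|n IH]; first by rewrite big_ord0 rat_natE.
  by rewrite big_ord_recr /= rat_addE IH.
rewrite dot_sumr -sumrB; apply: le_trans (ler_norm_sum _ _ _) _.
apply: (@le_trans _ _ (\sum_(j < Q) 2 ^- Q * 2 ^- j)).
  by apply: ler_sum => j _; exact: approx_termP.
by rewrite -mulr_sumr mulrC ler_wpM2r ?exp2V_ge0 ?sum_exp2V_le.
Qed.

Lemma approx_dotP i n : `|q (approx_dot i n) - '[a i, encoding]| <= 2 ^- n.+2.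
Proof.
set N := rat_pos (B i i 0); set Q := (n + 5 + i + N.+2)%N.
have iQ : (i < Q)%N by rewrite /Q; lia.
have aN : `|a i| <= N.+2%:R.
  have := B_dist i i 0; rewrite dotxx expr0 invr1 ler_norml => /andP[h _].
  have := rat_le_pos R (B i i 0); rewrite -/N => h'.
  by rewrite -natr1 -(natr1 N); have := normr_ge0 (a i); nra.
have := natr_exp2V R N.+2; have := ler0n R N.+2.
have e : 2 ^- Q = 2 ^- (n + 5 + i) * 2 ^- N.+2 :> R by rewrite /Q exprD invfM.
have e1 : 2 ^- (n + 5 + i) <= 2 ^- (n + 5) :> R by apply: ler_exp2V; lia.
have e2 : 2 ^- Q <= 2 ^- (n + 5) :> R by apply: ler_exp2V; rewrite /Q; lia.
have e3 : 2 ^- n.+2 = 8 * 2 ^- (n + 5) :> R.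
  by rewrite addnS (exp2VS R n.+2) (exp2VS R n.+3) (exp2VS R n.+4) !addnS addn0; ring.
have h1 := approx_sumP iQ.
have h2 : `|'[a i, encoding_sum Q - encoding]| <= N.+2%:R * (4 * 2 ^- Q).
  apply: le_trans (cauchy_schwarz _ _) _; apply: ler_pM => //.
  exact: encoding_cvg.2.
rewrite -(subrKA '[a i, encoding_sum Q]) -dotBr => h3 h4.
apply: le_trans (ler_normD _ _) _; apply: le_trans (lerD h1 h2) _.
have h5 : N.+2%:R * 2 ^- Q <= 2 ^- (n + 5) :> R.
  by rewrite e mulrCA; have := exp2V_ge0 R (n + 5 + i); nra.
by rewrite e3; have := exp2V_ge0 R (n + 5); lra.
Qed.

(** Otherwise [e (mu (T j))] would be almost orthogonal to [a i], hence to the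
    encoding, whose product with it is close to [2 ^- j * |e (mu (T j))| ^+ 2]. *)
Lemma encoding_decode i j : `|a i - encoding| <= 2 ^- (j + 4) ->
  (exists m, T j m) -> (mu (T j) < i + j + 5)%N.
Proof.
move=> iy ex; rewrite ltnNge; apply/negP; set k := mu (T j) => Mk.
have [e1 e2] := almost_basis_norm k.
have e4 : 2 ^- j = 16 * 2 ^- (j + 4) :> R.
  rewrite (exp2VS R j) (exp2VS R j.+1) (exp2VS R j.+2) (exp2VS R j.+3).
  by rewrite !addnS addn0; ring.
have k4 : 2 ^- k <= 2 ^- (j + 4) :> R.
  by apply: ler_exp2V; lia.
have ik : (i < k)%N.
  by lia.
(* The distance to [a i] contributes at most [2 * 2 ^- (j + 4)], as [|e k| <= 2], and the product
   with [a i] at most [2 ^- (j + 4)]. *)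
have up : '[encoding, e k] <= 3 * 2 ^- (j + 4).
  rewrite -['[_, _]](subrK '[a i, e k]) -dotBl.
  have := cauchy_schwarz (encoding - a i) (e k); rewrite distrC => h.
  have h' : `|'[a i, e k]| <= 2 ^- (j + 4).
    exact: le_trans (almost_basis_dense ik) k4.
  have := ler_norm '[encoding - a i, e k]; have := ler_norm '[a i, e k].
  have := normr_ge0 (a i - encoding); have := normr_ge0 (e k); nra.
have term n : - (2 ^- n * 2 ^- k) <= '[encoding_term n, e k].
  rewrite /encoding_term; case: pselect => h; last first.
    by rewrite dot0l oppr_le0 mulr_ge0 ?exp2V_ge0.
  rewrite dotZl -mulrN ler_wpM2l ?exp2V_ge0//.
  (* Different [n] may share the least witness [k]; such terms contribute a nonnegative amount. *)
  have [->|ne] := eqVneq (mu (T n)) k.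
    by rewrite dotxx; have := exp2V_ge0 R k; lra.
  have := almost_basis_dot (k := k) (l := mu (T n)); rewrite eq_sym ne => /(_ isT).
  by rewrite dotC ler_norml => /andP[].
(* The [j]-th term gives at least [2 ^- j / 2 = 8 * 2 ^- (j + 4)], and the others take away at most
   [2 * 2 ^- k <= 2 * 2 ^- (j + 4)]. *)
have low n : (j < n)%N -> 6 * 2 ^- (j + 4) <= '[encoding_sum n, e k].
  move=> jn; rewrite /encoding_sum dot_suml (bigD1 (Ordinal jn))//=.
  have -> : '[encoding_term j, e k] = 2 ^- j * `|e k| ^+ 2.
    by rewrite /encoding_term; case: pselect => // h; rewrite dotZl dotxx.
  have : - (2 * 2 ^- k) <=
      \sum_(i0 < n | i0 != Ordinal jn) '[encoding_term i0, e k].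
    apply: (@le_trans _ _ (\sum_(i0 < n | i0 != Ordinal jn) - (2 ^- i0 * 2 ^- k))).
      rewrite sumrN lerN2 -mulr_suml ler_wpM2r ?exp2V_ge0//.
      apply: le_trans (sum_exp2V_le R n).
      by rewrite [leRHS](bigD1 (Ordinal jn))//= lerDr exp2V_ge0.
    by apply: ler_sum => n' _; exact: term.
  by have := exp2V_ge0 R (j + 4); nra.
have : 6 * 2 ^- (j + 4) <= '[encoding, e k].
  have cv := @dot_cvgl R H _ _ (e k) encoding_cvg.1.
  rewrite -(cvg_lim (@Rhausdorff R) cv).
  apply: limr_ge; first exact: cvgP cv.
  by exists j.+1 => // n /= /low.
by have := exp2V_gt0 R (j + 4); lra.
Qed.

(** The head of what remains after dropping [n + 4] entries of the prefix of a name
    of [x] is the index of a point [2 ^- (n + 4)]-close to [x]. *)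
Definition encoding_associate (z : nat) : nat :=
  let d := iteri (nfst z + 4) (fun _ s => nsnd s.-1) (nsnd z) in
  if d == 0%N then 0%N else (approx_dot (nfst d.-1) (nfst z)).+1.

(** Dropping past the end is harmless, because the code [0] of the empty list is fixed by the
    step. *)
Lemma seq_code_drop n s :
  iteri n (fun _ s => nsnd s.-1) (seq_code s) = seq_code (drop n s).
Proof.
elim: n => [|n IH]; first by rewrite drop0.
rewrite /= IH -[in RHS]add1n -drop_drop.
by case: (drop n s) => [|x t] //=; rewrite drop0 npairK2.
Qed.

Lemma encoding_associateP (f : continuous_real_rep H) :
  (forall x, f x = '[x, encoding]) -> name (continuous_real_rep H) encoding_associate f.
Proof.
move=> fE s x sx; exists (fun n => approx_dot (s (n + 4)%N) n); split.
  (* This is the shortest prefix with an entry at position [n + 4]; every shorter one gets the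
     answer [0]. *)
  move=> n; exists (n + 4).+1; split=> [|j jn].
    rewrite /encoding_associate npairK1 npairK2 seq_code_drop mkseqS -cats1.
    by rewrite drop_size_cat ?size_mkseq//= npairK1.
  rewrite /encoding_associate npairK1 npairK2 seq_code_drop drop_oversize//.
  by rewrite size_mkseq.
apply: cauchy_nameI => n; rewrite fE.
(* Half of the error comes from [approx_dot], the other half from replacing [x] by a point within
   [2 ^- (n + 4)], multiplied by the norm bound [4]. *)
rewrite -(subrKA '[a (s (n + 4)%N), encoding]).
apply: le_trans (ler_normD _ _) _; rewrite -exp2VD lerD ?approx_dotP//.
rewrite -dotBl; apply: le_trans (cauchy_schwarz _ _) _.
have := cauchy_name_dist (n + 4) sx; have := encoding_norm.
have -> : 2 ^- n.+2 = 4 * 2 ^- (n + 4) :> R.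
  by rewrite (exp2VS R n.+2) (exp2VS R n.+3) !addnS addn0; ring.
have := normr_ge0 encoding; have := normr_ge0 (a (s (n + 4)%N) - x); nra.
Qed.

End EncodedSet.

Lemma computable_encoding_associate D (T : baire -> nat -> pred nat) :
  computable_on D (fun p z => T p (nfst z) (nsnd z)) ->
  computable_on D (fun p z => encoding_associate (T p) z).
Proof.
move=> cT.
have cfb F G : computable_on D F -> computable_on D G ->
    computable_on D (fun p z => first_below (T p (F p z)) (G p z)).
  apply: (@computable_app2 D (fun p j n => first_below (T p j) n)).
  apply: (@computable_first_below D (fun p z => T p (nfst z))); last by eauto with comp.
  apply: (@computable_app2 D (fun p n k => nat_of_bool (T p n k))); by eauto with comp.
have cs i Q : computable_on D i -> computable_on D Q ->
    computable_on D (fun p z => approx_sum (T p) (i p z) (Q p z)).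
  apply: (@computable_app2 D (fun p i Q => approx_sum (T p) i Q)).
  apply: (@computable_iteri D (fun p z j s =>
    rat_add s (approx_term (T p) (nfst z) (nsnd z) j))); try by eauto with comp.
  have c1 : computable_on D (fun p z =>
      first_below (T p (nfst (nsnd z))) (nsnd (nfst z))).
    by apply: cfb; eauto with comp.
  have cB : computable_on D (fun p z => B (nfst (nfst z))
      (sigma (first_below (T p (nfst (nsnd z))) (nsnd (nfst z)))) (nsnd (nfst z))).
    by apply: computable_B; try apply: computable_sigma; eauto with comp.
  by rewrite /approx_term; eauto 20 with comp.
have ca i n : computable_on D i -> computable_on D n ->
    computable_on D (fun p z => approx_dot (T p) (i p z) (n p z)).
  move=> ci cn; apply: cs => //.
  have cB : computable_on D (fun p z => B (i p z) (i p z) 0).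
    by apply: computable_B; eauto with comp.
  by rewrite /rat_pos; eauto 20 with comp.
have cd : computable_on D (fun p z =>
    iteri (nfst z + 4) (fun _ s => nsnd s.-1) (nsnd z)).
  by apply: computable_iteri; eauto with comp.
rewrite /encoding_associate /=.
apply: computable_if; [by eauto with comp|by eauto with comp|].
by apply: computable_succ; apply: ca; eauto with comp.
Qed.

End AlmostOrthonormal.

(** * Reduction of MCT to FRR *)

Section MCTReducesToFrechetRiesz.
Variables (R : realType) (H : computable_hilbert R).
Variable B : nat -> nat -> nat -> nat.
Hypothesis B_dist : forall i k l,
  `|rat_enum R (B i k l) - hdot H (hseq H i) (hseq H k)| <= 2 ^- l.
Hypothesis B_computable : forall D,
  computable_on D (fun _ z => B (nfst z) (nfst (nsnd z)) (nsnd (nsnd z))).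
Hypothesis infinite_dim : ~ finite_dimensional H.
Local Notation a := (hseq H).
Local Notation q := (rat_enum R).
Local Notation X := (seq_rep (real_rep R)).
Local Notation Y := (hrep H).

Definition rise_le (p : baire) (c l n m : nat) : bool :=
  rat_le (rat_add (p (npair m l)) (rat_opp (p (npair n l))))
    (rat_scale l (rat_nat c)).

Lemma seq_name_dist p (x : nat -> R) n l : name X p x ->
  `|q (p (npair n l)) - x n| <= 2 ^- l.
Proof. by move=> /(_ n) /(@real_name_dist _ _ _ l). Qed.

Lemma rise_leE p c l n m :
  rise_le p c l n m = (q (p (npair m l)) - q (p (npair n l)) <= c%:R * 2 ^- l).
Proof. by rewrite /rise_le (rat_leE R) rat_addE rat_oppE rat_scaleE rat_natE mulrC. Qed.

Lemma computable_rise_le D c (P : baire -> baire) l n m :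
  computable_on D (fun p z => P p z) ->
  computable_on D l -> computable_on D n -> computable_on D m ->
  computable_on D (fun p z => rise_le (P p) c (l p z) (n p z) (m p z)).
Proof.
move=> cP cl cn cm; rewrite /rise_le.
have c1 : computable_on D (fun p z => P p (npair (m p z) (l p z))).
  by apply: (computable_app cP); eauto with comp.
have c2 : computable_on D (fun p z => P p (npair (n p z) (l p z))).
  by apply: (computable_app cP); eauto with comp.
by eauto 20 with comp.
Qed.

(** [jump p (npair n l) m] certifies that the named sequence rises by more than
    [5 * 2 ^- l] from [n] to [m], and holds if it rises by more than [9 * 2 ^- l]. *)
Definition jump (p : baire) (j : nat) : pred nat :=
  fun m => ~~ rise_le p 7 (nsnd j) (nfst j) m.

(** [w] names the encoding of [jump p] for some name [p] of the sequence. No witness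
    for [npair n l] lies beyond the stage at which [p'] is tested here. *)
Definition settled (p' w : baire) (l n : nat) : bool :=
  rise_le p' 3 l n (w (npair n l + 4) + npair n l + 5).

(** A jump at [(n, l)] would have its least witness below the tested stage [M]; by monotonicity [x]
    would rise by more than [5 * 2 ^- l] up to [M], whereas the test allows at most [3 + 2] such
    units. Without a jump the supremum is within [9 * 2 ^- l] of [x n], and reading [x n] from [p']
    costs one unit more. *)
Lemma settled_dist p p' w (x : nat -> R) l n :
  name X p x -> name X p' x -> name Y w (encoding H B (jump p)) ->
  nondecreasing_seq x -> has_ubound (range x) ->
  settled p' w l n -> `|q (p' (npair n l)) - sup (range x)| <= 10 * 2 ^- l.
Proof.
move=> px p'x wy ndx ubx.
rewrite /settled rise_leE; set j := npair n l; set M := (_ + _ + _)%N => hM.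
have e0 := exp2V_ge0 R l.
have nojump m : q (p (npair m l)) - q (p (npair n l)) <= 7 * 2 ^- l.
  rewrite -rise_leE; apply/negPn/negP => jm.
  have ex : exists m, jump p j m by exists m; rewrite /jump /j npairK1 npairK2.
  have := encoding_decode B_dist infinite_dim (cauchy_name_dist (j + 4) wy) ex.
  rewrite -/M => /ltnW/ndx; move: (mu_ex ex); set k := mu _.
  rewrite {1}/jump {1}/j npairK1 npairK2 rise_leE -ltNge.
  move: (seq_name_dist k l px) (seq_name_dist n l px) (seq_name_dist n l p'x)
    (seq_name_dist M l p'x).
  rewrite !ler_norml => /andP[h1 h2] /andP[h3 h4] /andP[h5 h6] /andP[h7 h8].
  by lra.
have lo : x n <= sup (range x) by apply: ub_le_sup => //; exists n.
have up : sup (range x) <= x n + 9 * 2 ^- l.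
  apply: ge_sup; first by exists (x 0%N), 0%N.
  move=> _ [m _ <-]; have := nojump m.
  have := seq_name_dist m l px; have := seq_name_dist n l px.
  by rewrite !ler_norml => /andP[h1 h2] /andP[h3 h4]; lra.
have := seq_name_dist n l p'x.
by rewrite !ler_norml => /andP[h1 h2]; apply/andP; split; lra.
Qed.

(** If [x n] is within [2 ^- l] of the supremum, the later rise is at most one unit and the two
    approximations add at most two, whatever stage [w] prescribes. *)
Lemma settled_ex p' w (x : nat -> R) l : name X p' x ->
  nondecreasing_seq x -> has_ubound (range x) -> exists n, settled p' w l n.
Proof.
move=> p'x ndx ubx.
have hs : has_sup (range x) by split=> //; exists (x 0%N), 0%N.
have [_ [n _ <-] xn] := sup_adherent (exp2V_gt0 R l) hs.
exists n; rewrite /settled rise_leE; set M := (_ + _ + _)%N.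
have : x M <= sup (range x) by apply: ub_le_sup => //; exists M.
have := seq_name_dist n l p'x; have := seq_name_dist M l p'x.
by rewrite !ler_norml => /andP[h1 h2] /andP[h3 h4]; lra.
Qed.

(** The shift by [5] suffices because [10 * 2 ^- (i + 5) <= 2 ^- i.+1]. *)
Definition sup_search (r : baire) (i : nat) : nat :=
  even_part r
    (npair (mu (settled (even_part r) (odd_part r) (i + 5))) (i + 5)).

Lemma MCT_le_FRR : weihrauch_le (@MCT R) (@FRR R H).
Proof.
(* The vector depends on the name of [x], which the postprocessing may receive in a different form;
   hence the existential over [p] and the two names in [settled_dist]. *)
pose encodes (x : X) (y : Y) := exists p, name X p x /\ y = encoding H B (jump p).
exists (fun z s => MCT z.1 s /\ encodes z.1 z.2).
exists (fun x (f : continuous_real_rep H) => mdom (@MCT R) x /\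
  exists y, encodes x y /\ forall v, f v = hdot H v y).
pose F p : continuous_real_rep H :=
  (mkcts (@dot_continuous R H (encoding H B (jump p))) : continuousType H R^o).
have KP p (x : X) : name X p x -> mdom (@MCT R) x ->
    name (continuous_real_rep H) (encoding_associate B (jump p)) (F p) /\
    (mdom (@MCT R) x /\ exists y, encodes x y /\ forall v, F p v = hdot H v y).
  move=> px dx; split; first exact: (encoding_associateP B_dist infinite_dim).
  by split=> //; exists (encoding H B (jump p)); split=> //; exists p.
split.
- pose D := [set r | exists x : nat -> R, [/\ name X (even_part r) x,
    nondecreasing_seq x & has_ubound (range x)]].
  have [|c cP] := @computable_onP D sup_search.
    have cE : computable_on D (fun r n => even_part r n).
      by rewrite /even_part; eauto with comp.
    apply: (computable_app cE); apply: computable_npair; last by eauto with comp.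
    apply: computable_mu => [r i [x [rx ndx ubx]]|]; first exact: settled_ex rx _ _.
    by apply: (computable_rise_le _ cE); rewrite /odd_part; eauto 20 with comp.
  exists c => r [x y] [/= rx ry] [s [/= [ndx ubx sx] [p [px yp]]]].
  exists (sup_search r), s; split.
  - by apply: cP; exists x.
  - apply: real_nameI => i; rewrite sx /sup_search.
    rewrite yp in ry.
    have ex := settled_ex (odd_part r) (i + 5) rx ndx ubx.
    apply: le_trans (settled_dist px rx ry ndx ubx (mu_ex ex)) _.
    rewrite !addnS addn0 (exp2VS R i.+1) (exp2VS R i.+2) (exp2VS R i.+3) (exp2VS R i.+4).
    by move: (exp2V_ge0 R i.+4.+1); lra.
  - by split; [|exists p].
(* The predicate [jump p] is searched only below a bound, so the program halts on every oracle. *)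
- have [|c cP] := @computable_onP setT (fun p => encoding_associate B (jump p)).
    apply: (computable_encoding_associate B_dist B_computable infinite_dim).
    apply: computable_negb; apply: (@computable_rise_le _ 7 (fun p => p));
      by eauto with comp.
  exists c => p x px [f [dx _]].
  exists (encoding_associate B (jump p)), (F p).
  by have [h1 h2] := KP p x px dx; split=> //; exact: cP.
- move=> x dx; split.
    have [p px] := name_surj x.
    by exists (F p); exact: (KP p x px dx).2.
  move=> f [_ [y [xy fy]]]; split.
    exists y; split=> //; have -> : (f : H -> R) = fun v => hdot H v y by apply/funext.
    exact: bounded_linear_dot.
  move=> y' [_ fy']; have -> : y' = y by apply: dot_eq => v; rewrite -fy' fy.
  by split; [have [s xs] := dx; exists s|move=> s []].
Qed.

End MCTReducesToFrechetRiesz.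

Theorem theorem4p4 (R : realType) (H : computable_hilbert R)
    (infinite_dim : ~ finite_dimensional H) :
  (forall f : continuous_real_rep H, bounded_linear f ->
     (exists! y, @FRR R H f y) /\
     (forall y, @FRR R H f y -> `|y| = functional_norm f)) /\
  weihrauch_equiv (@FRR R H) (@MCT R).
Proof.
split=> [f bf|].
  split; last by move=> y [_ fy]; exact: functional_norm_dot.
  have [y fy] := riesz bf; exists y; split=> // y' [_ fy'].
  by apply: dot_eq => v; rewrite -fy fy'.
have [B [B_dist B_computable]] := dot_approximation H.
by split; [exact: FRR_le_MCT B_dist _|exact: MCT_le_FRR B_dist _ _].
Qed.
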